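(* Let $\mu$ be a positive Borel measure on $\mathbb C_+$. 1. If $\mu(Q(a))=O(\operatorname{Re}(a))$ for $a\in\mathbb C_+$, i.e. there is a constant $C>0$ with $\mu(Q(a))\le C\operatorname{Re}(a)$ for every $a\in\mathbb C_+$, then $\mu$ is a Carleson measure for $\mathcal D(\mathbb C_+)$. 2. If $\mu$ is a Carleson measure for $\mathcal D(\mathbb C_+)$, then $\mu(Q(a))=O(\operatorname{Re}(a)+1)$ for $a\in\mathbb C_+$, i.e. there is a constant $C>0$ with $\mu(Q(a))\le C(\operatorname{Re}(a)+1)$ for every $a\in\mathbb C_+$.
   Context: $\mathbb C_+=\{z\in\mathbb C:\operatorname{Re}z>0\}$ and $dz$ denotes area (Lebesgue) measure. The Dirichlet space $\mathcal D(\mathbb C_+)$ is the space of analytic $F$ on $\mathbb C_+$ with $$\|F\|^2_{\mathcal D(\mathbb C_+)}=\sup_{x>0}\int_{-\infty}^\infty|F(x+iy)|^2\frac{dy}{2\pi}+\int_{\mathbb C_+}|F'(z)|^2\frac{dz}{\pi}<\infty;$$ equivalently, it is the image under the Laplace transform $\mathfrak L[f](z)=\int_0^\infty f(t)e^{-tz}\,dt$ of the functions $f$ on $(0,\infty)$ with $\int_0^\infty|f(t)|^2(1+t)\,dt<\infty$, this integral being equal to $\|\mathfrak L[f]\|^2_{\mathcal D(\mathbb C_+)}$. For $a\in\mathbb C_+$, $Q(a)=\{x+iy:\ 0<x\le2\operatorname{Re}(a),\ |y-\operatorname{Im}(a)|\le\operatorname{Re}(a)\}$. $\mu$ is a Carleson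 measure for $\mathcal D(\mathbb C_+)$ if there is a constant $C>0$ with $\int_{\mathbb C_+}|F|^2\,d\mu\le C\|F\|^2_{\mathcal D(\mathbb C_+)}$ for all $F\in\mathcal D(\mathbb C_+)$. *)

(* Defs.v *)
From mathcomp Require Import all_boot all_order all_algebra.
From mathcomp Require Import all_classical all_reals all_analysis.
From mathcomp Require Import complex.

Set Implicit Arguments.
Unset Strict Implicit.
Unset Printing Implicit Defensive.

Import Order.TTheory GRing.Theory Num.Theory.
Import numFieldNormedType.Exports.

Local Open Scope classical_set_scope.
Local Open Scope ring_scope.
Local Open Scope complex_scope.

(* R[i]^o is R[i] seen as a normed module over itself: derivability of a map
   R[i]^o -> R[i]^o in the direction 1 is complex differentiability, [derive1]
   is the complex derivative, and [open] refers to the usual topology of the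
   plane. *)

(* The complex plane with its Borel sigma-algebra.  A Borel measure on Cplus is
   represented by a Borel measure on the plane, which is only ever evaluated on
   subsets of Cplus. *)
Definition borelC (R : realType) := g_sigma_algebraType (@open R[i]^o).

Definition Cplus (R : realType) : set R[i] := [set z | 0 < complex.Re z].

(* The square of the modulus, as an element of R (the MathComp norm `|w| of
   w : R[i] lives in R[i]). *)
Definition sqmod (R : realType) (w : R[i]) : R :=
  (ComplexField.Normc.normc w) ^+ 2.

Definition analytic_Cplus (R : realType) (F : R[i]^o -> R[i]^o) : Prop :=
  forall z, Cplus z -> derivable F z 1.

(* Only the values of F on Cplus matter.  The area integral over Cplus is taken
   in the real coordinates p = (x, y). *)
Definition dirichlet_sqnorm (R : realType) (F : R[i]^o -> R[i]^o) : \bar R :=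
  (ereal_sup [set \int[lebesgue_measure]_y
                    (sqmod (F (x +i* y)) / (2 * pi))%:E | x in [set x : R | (0 < x)%R]]
   + \int[lebesgue_measure \x lebesgue_measure]_(p in [set p : R * R | (0 < p.1)%R])
       (sqmod (derive1 F (p.1 +i* p.2)) / pi)%:E)%E.

Definition dirichlet_space (R : realType) : set (R[i]^o -> R[i]^o) :=
  [set F | analytic_Cplus F /\ (dirichlet_sqnorm F < +oo)%E].

Definition carleson_box (R : realType) (a : R[i]) : set R[i] :=
  [set z | (0 < complex.Re z <= 2 * complex.Re a) /\
           (`|complex.Im z - complex.Im a| <= complex.Re a)].

Definition carleson_measure (R : realType)
    (mu : {measure set (borelC R) -> \bar R}) : Prop :=
  exists2 C : R, 0 < C &
    forall F, @dirichlet_space R F ->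
      (\int[mu]_(z in @Cplus R) (sqmod (F z))%:E <= C%:E * dirichlet_sqnorm F)%E.

(* Main.v *)
Require Import Defs.
From mathcomp Require Import all_boot all_order all_algebra.
From mathcomp Require Import all_classical all_reals all_analysis.
From mathcomp Require Import complex.
From mathcomp Require Import measurable_realfun ring lra.

(** Sufficiency is the Carleson embedding theorem for the Hardy space of the
half-plane ([hardy_embedding]), since the supremum over vertical lines in the
squared Dirichlet norm is the squared Hardy norm.  For [F] analytic and
[x0 > 0], put [f t = |F (x0 + i t)|].  Integrating [(F w - F z) / ((w - z) (w - z'))] along
the boundary of a rectangle with left side on [Re w = x0], where [z'] is the
mirror image of [z] in that line, gives zero.  As the rectangle grows, only the
left side survives, and there the kernel is a negative multiple of the Poisson
kernel; hence [|F z|] is at most the integral of [h / (h^2 + (t - y)^2) f t], where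
[z = x0 + h + i y] ([poisson_bound]).  Nothing but complex differentiability at
each point is assumed of [F], so the vanishing of the contour integral is
Goursat's theorem, with one exceptional point at [z] ([goursat_punctured]).

The Poisson kernel is dominated by a geometric series of normalized indicators
of intervals of half-length [2^k h].  So if [|F z| > l], then [f] has a large
mean over some interval centred at [Im z] and at least as long as [h].  Vitali's
covering lemma selects disjoint ones among these intervals so that the boxes
over their dilates cover [{|F| > l}]; this bounds the measure of that set by a
multiple of the integral of [f] over [{f > l / 32}], divided by [l]
([weak_type]).  Summing over the levels [l = d 2^j] yields the integral of [f^2],
which is bounded by the squared Hardy norm whatever [x0] and [d]; both then tend to 0.

Necessity tests the Carleson inequality on [F z = 1 / (z + conj a)], the
reproducing kernel of the Hardy space at [a].  On the box of [a] it has
[|F|^2 >= 1 / (10 (Re a)^2)], while its squared Dirichlet norm is at most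
[1 / (2 Re a) + pi / (Re a)^2] ([test_fun_norm]).  The second term, coming from
the derivative, accounts for the [+ 1] in the conclusion. *)

Set Implicit Arguments.
Unset Strict Implicit.
Unset Printing Implicit Defensive.

Import Order.TTheory GRing.Theory Num.Theory.
Import numFieldNormedType.Exports.

Local Open Scope classical_set_scope.
Local Open Scope ring_scope.

(** * Moduli and complex differentiability *)

Section cmod.
Context {R : realType}.
Implicit Types z w : R[i].

(** The modulus with values in [R]: the norm of [R[i]] takes values in [R[i]]
    itself, which is inconvenient for real estimates. *)
Definition cmod z : R := ComplexField.Normc.normc z.

Lemma cmod_sqr z : cmod z ^+ 2 = complex.Re z ^+ 2 + complex.Im z ^+ 2.
Proof. by case: z => a b /=; rewrite sqr_sqrtr// addr_ge0 ?sqr_ge0. Qed.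

Lemma cmod_ge0 z : 0 <= cmod z.
Proof. by case: z => a b /=; exact: sqrtr_ge0. Qed.

Lemma cmodD z w : cmod (z + w) <= cmod z + cmod w.
Proof. exact: le_normcD. Qed.

Lemma cmodM z w : cmod (z * w) = cmod z * cmod w.
Proof. exact: ComplexField.Normc.normcM. Qed.

Lemma cmodV z : cmod z^-1 = (cmod z)^-1.
Proof. exact: ComplexField.Normc.normcV. Qed.

Lemma cmodN z : cmod (- z) = cmod z.
Proof. exact: normcN. Qed.

Lemma cmodB z w : cmod (z - w) = cmod (w - z).
Proof. by rewrite -cmodN opprB. Qed.

Lemma cmod0 : cmod 0 = 0.
Proof. exact: ComplexField.Normc.normc0. Qed.

Lemma cmod_eq0 z : (cmod z == 0) = (z == 0).
Proof.
apply/eqP/eqP => [|->]; last exact: cmod0.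
exact: ComplexField.Normc.eq0_normc.
Qed.

Lemma cmod_gt0 z : (0 < cmod z) = (z != 0).
Proof. by rewrite lt_def cmod_ge0 cmod_eq0 andbT. Qed.

Lemma normcE_cmod z : `|z| = (cmod z)%:C%C.
Proof. by []. Qed.

Lemma cReD z w : complex.Re (z + w) = complex.Re z + complex.Re w.
Proof. by case: z; case: w. Qed.
Lemma cImD z w : complex.Im (z + w) = complex.Im z + complex.Im w.
Proof. by case: z; case: w. Qed.
Lemma cReB z w : complex.Re (z - w) = complex.Re z - complex.Re w.
Proof. by case: z; case: w. Qed.
Lemma cImB z w : complex.Im (z - w) = complex.Im z - complex.Im w.
Proof. by case: z; case: w. Qed.
Lemma cReM z w : complex.Re (z * w) =
  complex.Re z * complex.Re w - complex.Im z * complex.Im w.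
Proof. by case: z; case: w. Qed.
Lemma cImM z w : complex.Im (z * w) =
  complex.Re z * complex.Im w + complex.Im z * complex.Re w.
Proof. by case: z; case: w. Qed.

Lemma norm_Re_le z : `|complex.Re z| <= cmod z.
Proof.
rewrite -(ler_pXn2r (n := 2)) ?nnegrE ?cmod_ge0//.
by rewrite cmod_sqr real_normK ?num_real// lerDl sqr_ge0.
Qed.

Lemma norm_Im_le z : `|complex.Im z| <= cmod z.
Proof.
rewrite -(ler_pXn2r (n := 2)) ?nnegrE ?cmod_ge0//.
by rewrite cmod_sqr real_normK ?num_real// lerDr sqr_ge0.
Qed.

Lemma cmod_le_ReIm z : cmod z <= `|complex.Re z| + `|complex.Im z|.
Proof.
rewrite -(ler_pXn2r (n := 2)) ?nnegrE ?cmod_ge0 ?addr_ge0//.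
rewrite cmod_sqr sqrrD !real_normK ?num_real// lerD2r lerDl.
by rewrite mulrn_wge0// mulr_ge0.
Qed.

(** Complex differentiability at [q] in terms of real moduli, the form in which
    the local linear approximation enters Goursat's argument. *)
Definition cdiff (G : R[i] -> R[i]) (q : R[i]) := exists L : R[i],
  forall e : R, 0 < e -> exists2 d : R, 0 < d &
    forall w, cmod (w - q) < d ->
      cmod (G w - G q - L * (w - q)) <= e * cmod (w - q).

Lemma derivable_cdiff (F : R[i]^o -> R[i]^o) (q : R[i]) :
  derivable F q 1 -> cdiff F q.
Proof.
move=> /cvg_ex[/= L /cvgrPdist_le/= HL]; exists L => e e0.
have e0' : (0 : R[i]) < (e%:C)%C by rewrite ltcE/= eqxx.
have := HL _ e0'.
move=> -[/= d d0 Hd].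
move: d0; rewrite /= ltcE/= => /andP[/eqP dIm dRe].
exists (complex.Re d) => // w wq.
have [->|wq0] := eqVneq w q.
  by rewrite !subrr mulr0 subr0 cmod0 mulr0.
have hq0 : w - q != 0 by rewrite subr_eq0.
have := Hd (w - q).
rewrite /ball_/= sub0r normrN normcE_cmod.
rewrite ltcE/= dIm eqxx/= => /(_ wq hq0).
rewrite /GRing.scale/= mulr1 subrK normcE_cmod lecE/= eqxx/= => H.
have E (u v : R[i]) : u != 0 -> v - L * u = - (u * (L - u^-1 * v)).
  by move=> u0; rewrite mulrBr mulrA divff// mul1r; ring.
rewrite (E (w - q) (F w - F q) hq0).
by rewrite cmodN cmodM mulrC ler_wpM2r// cmod_ge0.
Qed.

Lemma cdiff_cont G q : cdiff G q -> forall e : R, 0 < e ->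
  exists2 d : R, 0 < d & forall w, cmod (w - q) < d -> cmod (G w - G q) < e.
Proof.
move=> [L HL] e e0.
have [d d0 Hd] := HL 1 ltr01.
have L1 : 0 < cmod L + 1 by rewrite ltr_wpDl// cmod_ge0.
exists (Num.min d (e / (cmod L + 1))); first by rewrite lt_min d0 divr_gt0.
move=> w; rewrite lt_min => /andP[wd].
rewrite ltr_pdivlMr// => we.
rewrite -(subrK (L * (w - q)) (G w - G q)).
rewrite (le_lt_trans (cmodD _ _))// cmodM (le_lt_trans _ we)//.
rewrite [leRHS]mulrDr mulr1 [cmod L * _]mulrC [leRHS]addrC.
by rewrite lerD2r (le_trans (Hd _ wd))// mul1r.
Qed.

Lemma cdiff_cont_line_x G x y : cdiff G (x +i* y)%C ->
  {for x, continuous (fun x => complex.Re (G (x +i* y)%C))}.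
Proof.
move=> /cdiff_cont dG; apply/cvgrPdist_lt => e e0.
have [d d0 Hd] := dG _ e0.
near=> t.
rewrite distrC -cReB (le_lt_trans (norm_Re_le _))// Hd//.
rewrite (le_lt_trans (cmod_le_ReIm _))//= subrr normr0 addr0.
by near: t; apply: cvgr_distC_lt.
Unshelve. all: by end_near. Qed.

Lemma cdiff_cont_line_y G x y : cdiff G (x +i* y)%C ->
  {for y, continuous (fun y => complex.Im (G (x +i* y)%C))}.
Proof.
move=> /cdiff_cont dG; apply/cvgrPdist_lt => e e0.
have [d d0 Hd] := dG _ e0.
near=> t.
rewrite distrC -cImB (le_lt_trans (norm_Im_le _))// Hd//.
rewrite (le_lt_trans (cmod_le_ReIm _))//= subrr normr0 add0r.
by near: t; apply: cvgr_distC_lt.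
Unshelve. all: by end_near. Qed.

End cmod.

Section seg.
Context {R : realType}.
Implicit Types (f g : R -> R) (a b : R).
Notation mu := (@lebesgue_measure R).

(** Two-sided continuity, also at the endpoints: the functions integrated below
    are restrictions of functions continuous on a neighbourhood of the segment,
    and the property passes to subsegments. *)
Definition cont_on f a b := forall x, a <= x <= b -> {for x, continuous f}.

Definition seg f a b : R := \int[mu]_(x in `[a, b]) f x.

Lemma cont_on_integrable f a b : cont_on f a b ->
  mu.-integrable `[a, b] (EFin \o f).
Proof.
move=> cf; apply: continuous_compact_integrable; first exact: segment_compact.
by apply: continuous_in_subspaceT => x; rewrite inE/= in_itv/= => /cf.
Qed.

Lemma cont_onB f g a b : cont_on f a b -> cont_on g a b ->
  cont_on (fun x => f x - g x) a b.
Proof. by move=> cf cg x xab; apply: cvgB; [exact: cf|exact: cg]. Qed.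

Lemma segB f g a b : cont_on f a b -> cont_on g a b ->
  seg (fun x => f x - g x) a b = seg f a b - seg g a b.
Proof.
by move=> cf cg; rewrite /seg RintegralB//; exact: cont_on_integrable.
Qed.

Lemma seg_split f a m b : cont_on f a b -> a <= m -> m <= b ->
  seg f a b = seg f a m + seg f m b.
Proof.
move=> cf am mb; have := Rintegral_itvB (cont_on_integrable cf) (x := m).
rewrite !bnd_simp => /(_ am mb) /eqP; rewrite subr_eq addrC => /eqP /=.
rewrite /seg => ->; congr +%R.
rewrite Rintegral_itv_obnd_cbnd//.
apply: integrableS (cont_on_integrable cf) => //.
by apply: subset_itv; rewrite bnd_simp.
Qed.

Lemma seg_cst k a b : a <= b -> seg (fun=> k) a b = k * (b - a).
Proof.
move=> ab; rewrite /seg Rintegral_cst//= lebesgue_measure_itv/= lte_fin.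
case: ltP => //= ba; have -> : a = b by apply/eqP; rewrite eq_le ab ba.
by rewrite subrr mulr0.
Qed.

Lemma cst_cont_on k a b : cont_on (fun=> k) a b.
Proof. by move=> x _; exact: cvg_cst. Qed.

Lemma le_seg f g a b : cont_on f a b -> cont_on g a b ->
  (forall x, a <= x <= b -> f x <= g x) -> seg f a b <= seg g a b.
Proof.
move=> cf cg fg; apply: le_Rintegral => //; try exact: cont_on_integrable.
Qed.

Lemma seg_near_cst f k M a b : a <= b -> cont_on f a b ->
  (forall x, a <= x <= b -> `|f x - k| <= M) ->
  `|seg f a b - k * (b - a)| <= M * (b - a).
Proof.
move=> ab cf fM.
rewrite -(seg_cst k ab) -segB//; last exact: cst_cont_on.
have cfk : cont_on (fun x => f x - k) a b.
  by apply: cont_onB => //; exact: cst_cont_on.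
rewrite ler_norml -mulNr -(seg_cst M ab) -(seg_cst (- M) ab).
apply/andP; split; apply: le_seg; try exact: cst_cont_on; try exact: cfk.
- by move=> x /fM; rewrite ler_norml => /andP[].
- by move=> x /fM; rewrite ler_norml => /andP[].
Qed.

End seg.


(** * Goursat's theorem on rectangles *)

Section contour.
Context {R : realType}.
Implicit Types (G : R[i] -> R[i]) (a b c d x y : R).

(** The real part of the integral of [G] along the boundary of the rectangle
    [[a, b] x [c, d]], counterclockwise.  The real part is enough, as [G] may be
    multiplied by a unimodular constant; pairing opposite sides makes the
    integral of an affine function vanish integrand by integrand. *)
Definition re_contour G a b c d : R :=
  seg (fun x => complex.Re (G (x +i* c)%C - G (x +i* d)%C)) a b -
  seg (fun y => complex.Im (G (b +i* y)%C - G (a +i* y)%C)) c d.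

Definition cdiff_hline G a b y := forall x, a <= x <= b -> cdiff G (x +i* y)%C.
Definition cdiff_vline G c d x := forall y, c <= y <= d -> cdiff G (x +i* y)%C.

Lemma cdiff_hline_cont G a b y : cdiff_hline G a b y ->
  cont_on (fun x => complex.Re (G (x +i* y)%C)) a b.
Proof. by move=> hG x /hG; exact: cdiff_cont_line_x. Qed.

Lemma cdiff_vline_cont G c d x : cdiff_vline G c d x ->
  cont_on (fun y => complex.Im (G (x +i* y)%C)) c d.
Proof. by move=> hG y /hG; exact: cdiff_cont_line_y. Qed.

Lemma cdiff_hline_contB G a b c d : cdiff_hline G a b c -> cdiff_hline G a b d ->
  cont_on (fun x => complex.Re (G (x +i* c)%C - G (x +i* d)%C)) a b.
Proof.
move=> hc hd; under [X in cont_on X]eq_fun do rewrite cReB.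
by apply: cont_onB; exact: cdiff_hline_cont.
Qed.

Lemma cdiff_vline_contB G a b c d : cdiff_vline G c d a -> cdiff_vline G c d b ->
  cont_on (fun y => complex.Im (G (b +i* y)%C - G (a +i* y)%C)) c d.
Proof.
move=> hc hd; under [X in cont_on X]eq_fun do rewrite cImB.
by apply: cont_onB; exact: cdiff_vline_cont.
Qed.

Lemma re_contourE G a b c d : cdiff_hline G a b c -> cdiff_hline G a b d ->
  cdiff_vline G c d a -> cdiff_vline G c d b ->
  re_contour G a b c d =
  seg (fun x => complex.Re (G (x +i* c)%C)) a b -
  seg (fun x => complex.Re (G (x +i* d)%C)) a b -
  (seg (fun y => complex.Im (G (b +i* y)%C)) c d -
   seg (fun y => complex.Im (G (a +i* y)%C)) c d).
Proof.
move=> hc hd va vb; rewrite -!segB; try exact: cdiff_hline_cont; try exact: cdiff_vline_cont.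
rewrite /re_contour; congr (seg _ _ _ - seg _ _ _).
  by apply/funext => x; rewrite cReB.
by apply/funext => x; rewrite cImB.
Qed.

Lemma cdiff_hline_sub G a b a' b' y : cdiff_hline G a b y -> a <= a' -> b' <= b ->
  cdiff_hline G a' b' y.
Proof.
move=> hG aa bb x /andP[ax xb]; apply: hG.
by rewrite (le_trans aa ax) (le_trans xb bb).
Qed.

Lemma cdiff_vline_sub G a b a' b' y : cdiff_vline G a b y -> a <= a' -> b' <= b ->
  cdiff_vline G a' b' y.
Proof.
move=> hG aa bb x /andP[ax xb]; apply: hG.
by rewrite (le_trans aa ax) (le_trans xb bb).
Qed.

Lemma re_contour_splitx G a m b c d : a <= m -> m <= b ->
  cdiff_hline G a b c -> cdiff_hline G a b d ->
  cdiff_vline G c d a -> cdiff_vline G c d m -> cdiff_vline G c d b ->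
  re_contour G a b c d = re_contour G a m c d + re_contour G m b c d.
Proof.
move=> am mb hc hd va vm vb.
rewrite !re_contourE//; try exact: (cdiff_hline_sub hc); try exact: (cdiff_hline_sub hd).
rewrite !(@seg_split _ _ a m b)//; try exact: cdiff_hline_cont.
by ring.
Qed.

Lemma re_contour_splity G a b c m d : c <= m -> m <= d ->
  cdiff_hline G a b c -> cdiff_hline G a b m -> cdiff_hline G a b d ->
  cdiff_vline G c d a -> cdiff_vline G c d b ->
  re_contour G a b c d = re_contour G a b c m + re_contour G a b m d.
Proof.
move=> cm md hc hm hd va vb.
rewrite !re_contourE//; try exact: (cdiff_vline_sub va); try exact: (cdiff_vline_sub vb).
rewrite !(@seg_split _ _ c m d)//; try exact: cdiff_vline_cont.
by ring.
Qed.

(** If the differences of [G] across both pairs of sides are close to those of an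
    affine function (whose slope has imaginary part [k]), the two main terms
    cancel. *)
Lemma re_contour_near G a b c d (k M : R) : a <= b -> c <= d ->
  cdiff_hline G a b c -> cdiff_hline G a b d -> cdiff_vline G c d a -> cdiff_vline G c d b ->
  (forall x, a <= x <= b ->
    `|complex.Re (G (x +i* c)%C - G (x +i* d)%C) - k * (d - c)| <= M) ->
  (forall y, c <= y <= d ->
    `|complex.Im (G (b +i* y)%C - G (a +i* y)%C) - k * (b - a)| <= M) ->
  `|re_contour G a b c d| <= M * ((b - a) + (d - c)).
Proof.
move=> ab cd hc hd va vb Hx Hy.
have h1 := seg_near_cst ab (cdiff_hline_contB hc hd) Hx.
have h2 := seg_near_cst cd (cdiff_vline_contB va vb) Hy.
rewrite /re_contour mulrDr; move: h1 h2.
set S := seg _ _ _; set T := seg _ _ _ => h1 h2.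
have -> : S - T = (S - k * (d - c) * (b - a)) - (T - k * (b - a) * (d - c)).
  by ring.
by rewrite (le_trans (ler_normB _ _))// lerD.
Qed.

(** The contour integral of the linear approximation is zero, so only the error
    is integrated: it is at most [e] times the diameter on a contour whose
    length is comparable to the diameter. *)
Lemma re_contour_linear_approx G a b c d p q (L : R[i]) (e : R) :
  a <= p <= b -> c <= q <= d -> 0 <= e ->
  cdiff_hline G a b c -> cdiff_hline G a b d -> cdiff_vline G c d a -> cdiff_vline G c d b ->
  (forall x y, a <= x <= b -> c <= y <= d ->
    cmod (G (x +i* y)%C - G (p +i* q)%C - L * ((x +i* y) - (p +i* q))%C)
    <= e * cmod ((x +i* y) - (p +i* q))%C) ->
  `|re_contour G a b c d| <= 2 * e * ((b - a) + (d - c)) ^+ 2.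
Proof.
move=> /andP[ap pb] /andP[cq qd] e0 hc hd va vb H.
have ab := le_trans ap pb; have cd := le_trans cq qd.
rewrite expr2 mulrA; set l := _ + _.
have H' x y : a <= x <= b -> c <= y <= d ->
    cmod (G (x +i* y)%C - G (p +i* q)%C - L * ((x +i* y) - (p +i* q))%C)
    <= e * l.
  move=> /[dup] xab /andP[ax xb] /[dup] ycd /andP[cy yd].
  rewrite (le_trans (H _ _ xab ycd))// ler_wpM2l//.
  rewrite /l (le_trans (cmod_le_ReIm _))//= lerD// ler_norml; lra.
apply: (@re_contour_near _ _ _ _ _ (complex.Im L)) => //.
- move=> x xab.
  have := H' x c xab; rewrite lexx cd => /(_ erefl) h1.
  have := H' x d xab; rewrite lexx cd => /(_ erefl) h2.
  have h1' := le_trans (norm_Re_le _) h1.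
  have h2' := le_trans (norm_Re_le _) h2.
  have := lerD h1' h2' => /(le_trans (ler_normB _ _)).
  have -> : e * l + e * l = 2 * e * l by ring.
  apply: le_trans.
  by rewrite le_eqVlt; apply/orP; left; apply/eqP; congr (`|_|);
    rewrite !(cReB, cReM, cImB) /=; ring.
- move=> y ycd.
  have := H' b y; rewrite lexx ab => /(_ erefl ycd) h1.
  have := H' a y; rewrite lexx ab => /(_ erefl ycd) h2.
  have h1' := le_trans (norm_Im_le _) h1.
  have h2' := le_trans (norm_Im_le _) h2.
  have := lerD h1' h2' => /(le_trans (ler_normB _ _)).
  have -> : e * l + e * l = 2 * e * l by ring.
  apply: le_trans.
  by rewrite le_eqVlt; apply/orP; left; apply/eqP; congr (`|_|);
    rewrite !(cImB, cImM, cReB) /=; ring.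
Qed.

Lemma nested_intervals (u v : nat -> R) :
  (forall n, u n <= u n.+1) -> (forall n, v n.+1 <= v n) ->
  (forall n, u n <= v n) -> exists p, forall n, u n <= p <= v n.
Proof.
move=> /nondecreasing_seqP nu /nonincreasing_seqP nv uv.
have uvmn m n : u m <= v n.
  rewrite (le_trans (nu _ _ (leq_maxl m n)))//.
  by rewrite (le_trans (uv _))// nv// leq_maxr.
have hs n : ubound (range u) (v n) by move=> _ [m _ <-].
exists (sup (range u)) => n; apply/andP; split.
- by apply: ub_le_sup; [exists (v 0%N); exact: hs|exists n].
- by apply: ge_sup; [exists (u 0%N), 0%N|exact: hs].
Qed.

(** The bound [e * (half-perimeter)^2] is additive under quartering, so a
    rectangle violating it has a quarter violating it. *)
Lemma re_contour_quarter G a b c d (e : R) : a <= b -> c <= d ->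
  (forall x y, a <= x <= b -> c <= y <= d -> cdiff G (x +i* y)%C) ->
  let w := (b - a) / 2 in let k := (d - c) / 2 in
  e * ((b - a) + (d - c)) ^+ 2 < `|re_contour G a b c d| ->
  exists x y, [/\ x = a \/ x = a + w, y = c \/ y = c + k &
    e * (w + k) ^+ 2 < `|re_contour G x (x + w) y (y + k)|].
Proof.
move=> ab cd dG w k big; apply: contrapT => no.
have no' x y : x = a \/ x = a + w -> y = c \/ y = c + k ->
    `|re_contour G x (x + w) y (y + k)| <= e * (w + k) ^+ 2.
  by move=> hx hy; rewrite leNgt; apply/negP => ?; apply: no; exists x, y.
have h1 := no' _ _ (or_introl erefl) (or_introl erefl).
have h2 := no' _ _ (or_introl erefl) (or_intror erefl).
have h3 := no' _ _ (or_intror erefl) (or_introl erefl).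
have h4 := no' _ _ (or_intror erefl) (or_intror erefl).
have w0 : 0 <= w by rewrite divr_ge0// subr_ge0.
have k0 : 0 <= k by rewrite divr_ge0// subr_ge0.
have bE : a + w + w = b by rewrite -addrA -splitr addrC subrK.
have dE : c + k + k = d by rewrite -addrA -splitr addrC subrK.
have am : a <= a + w by rewrite lerDl.
have mb : a + w <= b by rewrite -bE lerDl.
have cm : c <= c + k by rewrite lerDl.
have md : c + k <= d by rewrite -dE lerDl.
rewrite bE in h3 h4; rewrite dE in h2 h4.
have H y : c <= y <= d -> cdiff_hline G a b y by move=> ycd x xab; exact: dG.
have V x : a <= x <= b -> cdiff_vline G c d x by move=> xab y ycd; exact: dG.
have aab : a <= a <= b by rewrite lexx.
have bab : a <= b <= b by rewrite lexx ab.
have mab : a <= a + w <= b by rewrite am.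
have ccd : c <= c <= d by rewrite lexx.
have dcd : c <= d <= d by rewrite lexx cd.
have mcd : c <= c + k <= d by rewrite cm.
move: big; rewrite (@re_contour_splitx _ a (a + w) b)//; try exact: H; try exact: V.
rewrite (@re_contour_splity _ a (a + w) c (c + k) d)//; try exact: V; last 3 first.
- by apply: cdiff_hline_sub (H _ ccd) _ _.
- by apply: cdiff_hline_sub (H _ mcd) _ _.
- by apply: cdiff_hline_sub (H _ dcd) _ _.
rewrite (@re_contour_splity _ (a + w) b c (c + k) d)//; try exact: V; last 3 first.
- by apply: cdiff_hline_sub (H _ ccd) _ _.
- by apply: cdiff_hline_sub (H _ mcd) _ _.
- by apply: cdiff_hline_sub (H _ dcd) _ _.
apply/negP; rewrite -leNgt.
rewrite (le_trans (ler_normD _ _))//.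
rewrite (le_trans (lerD (ler_normD _ _) (ler_normD _ _)))//.
rewrite (le_trans (lerD (lerD h1 h2) (lerD h3 h4)))// le_eqVlt; apply/orP; left.
by apply/eqP; rewrite -bE -dE; ring.
Qed.

Lemma exists_div_exp2_lt (l e : R) : 0 < e -> exists n, l / 2 ^+ n < e.
Proof.
move=> e0.
have l1 : 0 < `|l| + 1 by rewrite ltr_wpDl.
have : `|l| + 1 < e * 2 ^+ (Num.bound ((`|l| + 1) / e)).
  rewrite -ltr_pdivrMl// mulrC.
  apply: (lt_le_trans (archi_boundP _)); first by rewrite divr_ge0// ltW.
  by rewrite -natrX ler_nat ltnW// ltn_expl.
move=> H; exists (Num.bound ((`|l| + 1) / e)).
rewrite ltr_pdivrMr ?exprn_gt0// (le_lt_trans _ H)// (le_trans (ler_norm _))//.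
by rewrite lerDl.
Qed.


End contour.

Section goursat.
Context {R : realType}.
Implicit Types (G : R[i] -> R[i]) (a b c d x y : R).

(** Quartering a rectangle that violates the bound [e * (half-perimeter)^2]
    produces nested violating rectangles; they shrink to a point, where
    differentiability contradicts the violation. *)
Theorem goursat G a b c d : a <= b -> c <= d ->
  (forall x y, a <= x <= b -> c <= y <= d -> cdiff G (x +i* y)%C) ->
  re_contour G a b c d = 0.
Proof.
move=> ab cd dG.
pose w n : R := (b - a) / 2 ^+ n; pose k n : R := (d - c) / 2 ^+ n.
have w0 n : 0 <= w n by rewrite divr_ge0 ?subr_ge0// exprn_ge0.
have k0 n : 0 <= k n by rewrite divr_ge0 ?subr_ge0// exprn_ge0.
have wS n : w n = w n.+1 + w n.+1.
  by rewrite /w exprS invfM; field; rewrite expf_neq0.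
have kS n : k n = k n.+1 + k n.+1.
  by rewrite /k exprS invfM; field; rewrite expf_neq0.
suff small e : 0 < e -> `|re_contour G a b c d| <= e * ((b - a) + (d - c)) ^+ 2.
  set l := _ + _ in small.
  apply/eqP; rewrite -normr_eq0 eq_le normr_ge0 andbT.
  apply/ler_addgt0Pr => e e0; rewrite add0r.
  have l2 : 0 < l ^+ 2 + 1 by rewrite ltr_wpDl// sqr_ge0.
  rewrite (le_trans (small _ (divr_gt0 e0 l2)))//.
  by rewrite mulrAC ler_pdivrMr// ler_pM2l// lerDl.
move=> e0; rewrite leNgt; apply/negP => big.
(* [bad n p]: the rectangle of the n-th generation with lower left corner [p]
   violates the bound. *)
pose bad n (p : R * R) := [/\ a <= p.1, p.1 + w n <= b, c <= p.2, p.2 + k n <= d &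
  e * (w n + k n) ^+ 2 < `|re_contour G p.1 (p.1 + w n) p.2 (p.2 + k n)|].
have step n (p : R * R) : exists p' : R * R, bad n p ->
   [/\ bad n.+1 p', p.1 <= p'.1 <= p.1 + w n.+1 & p.2 <= p'.2 <= p.2 + k n.+1].
  have [[ap pb cp pd bp]|nb] := pselect (bad n p); last by exists p => /nb.
  have pw : p.1 <= p.1 + w n by rewrite lerDl.
  have pk : p.2 <= p.2 + k n by rewrite lerDl.
  have := @re_contour_quarter R G p.1 (p.1 + w n) p.2 (p.2 + k n) e pw pk.
  have -> : (p.1 + w n - p.1) / 2 = w n.+1 by rewrite wS; field.
  have -> : (p.2 + k n - p.2) / 2 = k n.+1 by rewrite kS; field.
  have -> : (p.1 + w n - p.1) = w n by ring.
  have -> : (p.2 + k n - p.2) = k n by ring.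
  case=> [x y /andP[? ?] /andP[? ?]||x [y [hx hy hb]]] //.
    by apply: dG; lra.
  have w1 := w0 n.+1; have k1 := k0 n.+1; have wE := wS n; have kE := kS n.
  exists (x, y) => _; split => /=.
  - split => //=.
    + by clear - hx ap w1; case: hx => ->; lra.
    + by clear - hx pb w1 wE; case: hx => ->; lra.
    + by clear - hy cp k1; case: hy => ->; lra.
    + by clear - hy pd k1 kE; case: hy => ->; lra.
  - by clear - hx w1; case: hx => ->; lra.
  - by clear - hy k1; case: hy => ->; lra.
pose f n p := projT1 (cid (step n p)).
have fP n p := projT2 (cid (step n p)).
pose s := fix s n : R * R := if n is m.+1 then f m (s m) else (a, c).
have sb n : bad n (s n).
  elim: n => [|n IH]; last by have [] := fP n _ IH.
  rewrite /bad /w /k /= expr0 !divr1; split => //; try lra.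
  have -> : a + (b - a) = b by ring.
  by have -> : c + (d - c) = d by ring.
have s1 n : (s n).1 <= (s n.+1).1 <= (s n).1 + w n.+1 by have [] := fP n _ (sb n).
have s2 n : (s n).2 <= (s n.+1).2 <= (s n).2 + k n.+1 by have [] := fP n _ (sb n).
have [p hp] : exists p, forall n, (s n).1 <= p <= (s n).1 + w n.
  apply: nested_intervals => n; have := s1 n; have := wS n; have := w0 n; lra.
have [q hq] : exists q, forall n, (s n).2 <= q <= (s n).2 + k n.
  apply: nested_intervals => n; have := s2 n; have := kS n; have := k0 n; lra.
have [n0a n0b n0c n0d _] := sb 0%N.
have [L HL] : cdiff G (p +i* q)%C.
  by apply: dG; [have := hp 0%N|have := hq 0%N]; lra.
have [D D0 HD] := HL _ (divr_gt0 e0 (ltr0n _ 2)).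
have [n hn] := exists_div_exp2_lt ((b - a) + (d - c)) D0.
have [na nb nc nd hbad] := sb n.
have wk : w n + k n < D by rewrite /w /k -mulrDl.
have hpn := hp n; have hqn := hq n.
have dG' x y : (s n).1 <= x <= (s n).1 + w n -> (s n).2 <= y <= (s n).2 + k n ->
    cdiff G (x +i* y)%C.
  move=> hx hy; apply: dG; first by clear - na nb hx; lra.
  by clear - nc nd hy; lra.
have wn := w0 n; have kn := k0 n.
have i1 : (s n).1 <= (s n).1 <= (s n).1 + w n by rewrite lexx lerDl.
have i2 : (s n).1 <= (s n).1 + w n <= (s n).1 + w n by rewrite lexx lerDl wn.
have i3 : (s n).2 <= (s n).2 <= (s n).2 + k n by rewrite lexx lerDl.
have i4 : (s n).2 <= (s n).2 + k n <= (s n).2 + k n by rewrite lexx lerDl kn.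
have key : `|re_contour G (s n).1 ((s n).1 + w n) (s n).2 ((s n).2 + k n)| <=
    2 * (e / 2) * (((s n).1 + w n - (s n).1) + ((s n).2 + k n - (s n).2)) ^+ 2.
  apply: (@re_contour_linear_approx _ _ _ _ _ _ p q L) => //.
  - by rewrite ltW// divr_gt0.
  - by move=> x hx; exact: dG'.
  - by move=> x hx; exact: dG'.
  - by move=> x hx; exact: dG'.
  - by move=> x hx; exact: dG'.
  - move=> x y /andP[x1 x2] /andP[y1 y2].
    move: hpn hqn => /andP[p1 p2] /andP[q1 q2].
    apply: HD; apply: le_lt_trans wk; apply: (le_trans (cmod_le_ReIm _)) => /=.
    have l1 : `|x - p| <= w n by clear - x1 x2 p1 p2; rewrite ler_norml; lra.
    have l2 : `|y - q| <= k n by clear - y1 y2 q1 q2; rewrite ler_norml; lra.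
    exact: lerD.
move: key.
have -> : ((s n).1 + w n - (s n).1) = w n by ring.
have -> : ((s n).2 + k n - (s n).2) = k n by ring.
have -> : 2 * (e / 2) = e by field.
by rewrite leNgt hbad.
Qed.


End goursat.

Section goursat_punctured.
Context {R : realType}.
Implicit Types (G : R[i] -> R[i]) (a b c d x y : R).

(** The four rectangles surrounding the inner one contribute nothing by
    Goursat's theorem. *)
Lemma re_contour_hollow G a x1 x2 b c y1 y2 d :
  a <= x1 -> x1 <= x2 -> x2 <= b -> c <= y1 -> y1 <= y2 -> y2 <= d ->
  (forall x y, a <= x <= b -> c <= y <= d ->
     [\/ x <= x1, x2 <= x, y <= y1 | y2 <= y] -> cdiff G (x +i* y)%C) ->
  re_contour G a b c d = re_contour G x1 x2 y1 y2.
Proof.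
move=> ax x12 xb cy y12 yd dG.
have ax2 := le_trans ax x12; have x1b := le_trans x12 xb.
have cy2 := le_trans cy y12; have y1d := le_trans y12 yd.
have ab := le_trans ax x1b; have cd := le_trans cy y1d.
have H y l r : a <= l -> r <= b -> c <= y <= d -> y <= y1 \/ y2 <= y -> cdiff_hline G l r y.
  move=> al rb hy hy' x /andP[lx xr]; apply: dG => //.
    by rewrite (le_trans al lx) (le_trans xr rb).
  by case: hy' => ?; [constructor 3|constructor 4].
have V x l r : c <= l -> r <= d -> a <= x <= b -> x <= x1 \/ x2 <= x -> cdiff_vline G l r x.
  move=> cl rd hx hx' y /andP[ly yr]; apply: dG => //.
    by rewrite (le_trans cl ly) (le_trans yr rd).
  by case: hx' => ?; [constructor 1|constructor 2].
have Hc l r : a <= l -> r <= b -> cdiff_hline G l r c.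
  by move=> ? ?; apply: H; rewrite ?lexx//; left.
have Hd l r : a <= l -> r <= b -> cdiff_hline G l r d.
  by move=> ? ?; apply: H; rewrite ?lexx ?cd//; right.
have H1 l r : a <= l -> r <= b -> cdiff_hline G l r y1.
  by move=> ? ?; apply: H; rewrite ?lexx ?cy//; left.
have H2 l r : a <= l -> r <= b -> cdiff_hline G l r y2.
  by move=> ? ?; apply: H; rewrite ?lexx ?cy2//; right.
have Va l r : c <= l -> r <= d -> cdiff_vline G l r a.
  by move=> ? ?; apply: V; rewrite ?lexx//; left.
have Vb l r : c <= l -> r <= d -> cdiff_vline G l r b.
  by move=> ? ?; apply: V; rewrite ?lexx ?ab//; right.
have V1 l r : c <= l -> r <= d -> cdiff_vline G l r x1.
  by move=> ? ?; apply: V; rewrite ?lexx ?ax//; left.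
have V2 l r : c <= l -> r <= d -> cdiff_vline G l r x2.
  by move=> ? ?; apply: V; rewrite ?lexx ?ax2//; right.
rewrite (re_contour_splitx ax x1b (Hc _ _ _ _) (Hd _ _ _ _) (Va _ _ _ _)
  (V1 _ _ _ _) (Vb _ _ _ _))//.
rewrite goursat ?add0r//; last first.
  move=> x y /andP[ax' xx] hy; apply: dG => //; last by constructor 1.
  by rewrite ax' (le_trans xx).
rewrite (re_contour_splitx x12 xb (Hc _ _ _ _) (Hd _ _ _ _) (V1 _ _ _ _)
  (V2 _ _ _ _) (Vb _ _ _ _))//.
rewrite [X in _ + X]goursat ?addr0//; last first.
  move=> x y /andP[xx xb'] hy; apply: dG => //; last by constructor 2.
  by rewrite xb' (le_trans _ xx).
rewrite (re_contour_splity cy y1d (Hc _ _ _ _) (H1 _ _ _ _) (Hd _ _ _ _)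
  (V1 _ _ _ _) (V2 _ _ _ _))//.
rewrite goursat ?add0r//; last first.
  move=> x y /andP[x1x xx2] /andP[cy' yy]; apply: dG; last by constructor 3.
    by rewrite (le_trans ax) ?(le_trans xx2).
  by rewrite cy' (le_trans yy).
rewrite (re_contour_splity y12 yd (H1 _ _ _ _) (H2 _ _ _ _) (Hd _ _ _ _)
  (V1 _ _ _ _) (V2 _ _ _ _))//.
rewrite [X in _ + X]goursat ?addr0// => x y /andP[x1x xx2] /andP[yy yd'].
apply: dG; last by constructor 4.
  by rewrite (le_trans ax) ?(le_trans xx2).
by rewrite yd' (le_trans _ yy).
Qed.

(** A bounded isolated exceptional point is harmless: the contour can be shrunk to
    a square of side [2 t] around it, where the integral is at most [8 M t]. *)
Theorem goursat_punctured G a b c d p q (M r : R) :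
  a < p < b -> c < q < d -> 0 < r ->
  (forall x y, a <= x <= b -> c <= y <= d -> (x, y) <> (p, q) ->
     cdiff G (x +i* y)%C) ->
  (forall w, cmod (w - (p +i* q)%C) < r -> cmod (G w) <= M) ->
  re_contour G a b c d = 0.
Proof.
move=> /andP[ap pb] /andP[cq qd] r0 dG GM.
have M0 : 0 <= M.
  by apply: (le_trans (cmod_ge0 _) (GM (p +i* q)%C _)); rewrite subrr cmod0.
suff small t : 0 < t -> t <= p - a -> t <= b - p -> t <= q - c -> t <= d - q ->
    t < r / 2 -> `|re_contour G a b c d| <= 8 * M * t.
  apply/eqP; rewrite -normr_eq0 eq_le normr_ge0 andbT.
  apply/ler_addgt0Pr => e e0; rewrite add0r.
  pose t := Num.min (Num.min (p - a) (b - p))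
    (Num.min (Num.min (q - c) (d - q)) (Num.min (r / 4) (e / (8 * M + 1)))).
  have M1 : 0 < 8 * M + 1 by lra.
  have /(small t) : 0 < t by rewrite !lt_min !subr_gt0 ap pb cq qd !divr_gt0.
  have : t <= t by [].
  rewrite {2}/t !le_min => /andP[/andP[-> ->] /andP[/andP[-> ->] /andP[tr te]]].
  move=> /(_ erefl erefl erefl erefl) h.
  apply: (le_trans (h _)); first by lra.
  have t0 : 0 <= t by rewrite !le_min !subr_ge0 !(ltW ap, ltW pb, ltW cq, ltW qd) !divr_ge0// ltW.
  by move: te; rewrite ler_pdivlMr//; lra.
move=> t0 tpa tbp tqc tdq tr.
have tpt x : x - t <= x + t by clear - t0; lra.
have dS x y : a <= x <= b -> c <= y <= d ->
    [\/ x <= p - t, p + t <= x, y <= q - t | q + t <= y] -> cdiff G (x +i* y)%C.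
  move=> hx hy h; apply: dG => // -[xp yq]; rewrite xp yq in h.
  by case: h; clear - t0; lra.
have e1 : a <= p - t by clear - tpa; lra.
have e2 : p + t <= b by clear - tbp; lra.
have e3 : c <= q - t by clear - tqc; lra.
have e4 : q + t <= d by clear - tdq; lra.
rewrite (re_contour_hollow e1 (tpt p) e2 e3 (tpt q) e4 dS).
have dS' x y : p - t <= x <= p + t -> q - t <= y <= q + t ->
    [\/ x <= p - t, p + t <= x, y <= q - t | q + t <= y] -> cdiff G (x +i* y)%C.
  move=> /andP[? ?] /andP[? ?]; apply: dS.
    by rewrite (le_trans e1) ?(le_trans _ e2).
  by rewrite (le_trans e3) ?(le_trans _ e4).
have GM' x y : p - t <= x <= p + t -> q - t <= y <= q + t -> cmod (G (x +i* y)%C) <= M.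
  move=> hx hy; apply: GM; apply: (le_lt_trans (cmod_le_ReIm _)) => /=.
  have l1 : `|x - p| <= t by clear - hx; rewrite ler_norml; lra.
  have l2 : `|y - q| <= t by clear - hy; rewrite ler_norml; lra.
  by rewrite (le_lt_trans (lerD l1 l2))//; clear - tr; lra.
have -> : 8 * M * t = 2 * M * ((p + t - (p - t)) + (q + t - (q - t))) by ring.
apply: (@re_contour_near R _ _ _ _ _ 0) => //.
- by move=> x hx; apply: dS' => //; rewrite ?lexx ?tpt//; constructor 3.
- by move=> x hx; apply: dS' => //; rewrite ?lexx ?tpt//; constructor 4.
- by move=> x hx; apply: dS' => //; rewrite ?lexx ?tpt//; constructor 1.
- by move=> x hx; apply: dS' => //; rewrite ?lexx ?tpt//; constructor 2.
- move=> x hx; rewrite mul0r subr0 (le_trans (norm_Re_le _))//.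
  rewrite (le_trans (cmodD _ _))// cmodN mulr_natl mulr2n.
  by rewrite lerD// GM'// lexx tpt.
- move=> y hy; rewrite mul0r subr0 (le_trans (norm_Im_le _))//.
  rewrite (le_trans (cmodD _ _))// cmodN mulr_natl mulr2n.
  by rewrite lerD// GM'// lexx tpt.
Qed.

End goursat_punctured.


(** * Lorentzian integrals and measurability in the plane *)

Section real_integrals.
Context {R : realType}.
Notation mu := (@lebesgue_measure R).

Lemma seg_EFin (f : R -> R) a b : cont_on f a b ->
  (\int[mu]_(x in `[a, b]) (f x)%:E = (seg f a b)%:E)%E.
Proof.
move=> /cont_on_integrable cf; rewrite /seg /Rintegral fineK//.
exact: integrable_fin_num.
Qed.

(** Monotone convergence along the segments [[-n, n]]. *)
Lemma integral_le_of_segs (f : R -> R) (B : \bar R) : measurable_fun setT f ->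
  (forall x, 0 <= f x) ->
  (forall n : nat, (\int[mu]_(x in [set` `[- (n%:R : R), (n%:R : R)]%R]) (f x)%:E <= B)%E) ->
  (\int[mu]_x (f x)%:E <= B)%E.
Proof.
move=> mf f0 fB.
pose I (n : nat) : set R := `[- n%:R, n%:R]%classic.
have IT : \bigcup_n I n = setT.
  apply/seteqP; split=> // x _; exists (Num.bound `|x|) => //.
  by rewrite /I/= in_itv/= -ler_norml ltW// archi_boundP.
have ndI : nondecreasing_seq I.
  apply/nondecreasing_seqP => n; rewrite subsetEset.
  by apply: subset_itv; rewrite bnd_simp ?lerN2 ler_nat.
have mI n : measurable (I n) by exact: measurable_itv.
have mfI n : measurable_fun (I n) (fun x => (f x)%:E).
  by apply/measurable_EFinP; exact: measurable_funTS.
have fI0 n x : I n x -> (0 <= (f x)%:E)%E by rewrite lee_fin.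
have cv := ge0_nondecreasing_set_cvg_integral (mu := mu) ndI mI mfI fI0.
rewrite -IT -(cvg_lim _ cv)//; apply: lime_le; first by apply/cvg_ex; eexists; exact: cv.
by apply: nearW => n; exact: fB.
Qed.

(** Up to normalization, the Poisson kernel of the half-plane at height [s]. *)
Definition lorentz (s b y : R) := (s ^+ 2 + (y - b) ^+ 2)^-1.

Lemma lorentz_den_gt0 (s b y : R) : 0 < s -> 0 < s ^+ 2 + (y - b) ^+ 2.
Proof. by move=> s0; rewrite ltr_pwDl ?exprn_gt0// sqr_ge0. Qed.

Lemma lorentz_gt0 (s b y : R) : 0 < s -> 0 < lorentz s b y.
Proof. by move=> s0; rewrite invr_gt0 lorentz_den_gt0. Qed.

Lemma lorentz_cont (s b : R) : 0 < s -> continuous (lorentz s b).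
Proof.
move=> s0 y; apply: cvgV; first by rewrite gt_eqF// lorentz_den_gt0.
apply: cvgD; first exact: cvg_cst.
by rewrite expr2; under eq_fun do rewrite expr2;
  apply: cvgM; apply: cvgB; try exact: cvg_cst; exact: cvg_id.
Qed.

Lemma lorentz_meas (s b : R) : 0 < s -> measurable_fun setT (lorentz s b).
Proof. by move=> s0; apply: continuous_measurable_fun; exact: lorentz_cont. Qed.

Lemma is_derive_lorentz (s b y : R) : 0 < s ->
  is_derive y 1 (fun y => s^-1 * atan (s^-1 * (y - b))) (lorentz s b y).
Proof.
move=> s0.
have h1 : is_derive y 1 (fun y => s^-1 *: (y - b)) s^-1.
  apply: is_derive_eq; by rewrite subr0 /GRing.scale/= mulr1.
have d1 := @ex_derive _ _ _ _ _ _ _ h1.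
have h2 := is_derive1_atan (s^-1 *: (y - b)).
have d2 := @ex_derive _ _ _ _ _ _ _ h2.
have d12 : derivable (atan \o (fun y => s^-1 *: (y - b))) y 1.
  apply/derivable1_diffP; apply: (@differentiable_comp _ _ _ _ _ atan).
    by apply/derivable1_diffP; exact: d1.
  by apply/derivable1_diffP; exact: d2.
have h12 : is_derive y 1 (atan \o (fun y => s^-1 *: (y - b)))
    ((1 + (s^-1 *: (y - b)) ^+ 2)^-1 * s^-1).
  apply: DeriveDef => //.
  rewrite -derive1E (derive1_comp d1 d2) !derive1E.
  by rewrite (@derive_val _ _ _ _ _ _ _ h1) (@derive_val _ _ _ _ _ _ _ h2).
have h3 := is_deriveZ s^-1 h12.
apply: (is_derive_eq h3).
rewrite /lorentz /GRing.scale/=; field.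
by rewrite (gt_eqF (lorentz_den_gt0 b y s0)) (gt_eqF s0).
Qed.


Lemma seg_lorentz (s b c d : R) : 0 < s -> c <= d ->
  seg (lorentz s b) c d <= pi / s.
Proof.
move=> s0; rewrite le_eqVlt => /predU1P[->|cd].
  by rewrite /seg set_itv1 Rintegral_set1 divr_ge0// ?pi_ge0// ltW.
pose F y := s^-1 * atan (s^-1 * (y - b)).
have dF (y : R) : is_derive y 1 F (lorentz s b y) by exact: is_derive_lorentz.
have cF (y : R) : {for y, continuous F}.
  by apply: differentiable_continuous; apply/derivable1_diffP; exact: ex_derive.
have := @continuous_FTC2 R (lorentz s b) F c d cd.
rewrite seg_EFin; last by move=> x _; exact: lorentz_cont.
have cl : {within `[c, d], continuous (lorentz s b)}.
  by apply: continuous_subspaceT; exact: lorentz_cont.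
have dLR : derivable_oo_LRcontinuous F c d.
  split; first by move=> x _; exact: (@ex_derive _ _ _ _ _ _ _ (dF x)).
    by apply: cvg_at_right_filter; exact: cF.
  by apply: cvg_at_left_filter; exact: cF.
have F' : {in `]c, d[, derive1 F =1 lorentz s b}.
  by move=> x _; rewrite derive1E (@derive_val _ _ _ _ _ _ _ (dF x)).
move=> /(_ cl dLR F'); rewrite -EFinB => -[->].
rewrite /F -mulrBr mulrC ler_pM2r ?invr_gt0//.
have := atan_ltpi2 (s^-1 * (d - b)); have := atan_gtNpi2 (s^-1 * (c - b)).
set u := atan _; set v := atan _; clear; lra.
Qed.

Lemma integral_lorentz (s b : R) : 0 < s ->
  (\int[mu]_y (lorentz s b y)%:E <= (pi / s)%:E)%E.
Proof.
move=> s0; apply: integral_le_of_segs.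
- exact: lorentz_meas.
- by move=> y; rewrite ltW// lorentz_gt0.
- move=> n; rewrite seg_EFin; last by move=> x _; exact: lorentz_cont.
  by rewrite lee_fin seg_lorentz// lerNl (le_trans _ (ler0n _ _))// oppr_le0.
Qed.

(** The product sigma-algebra contains the open sets of the plane, because an open
    set is a union of boxes with rational centres and radii [1 / n]. *)
Lemma measurable_of_boxes (A : set (R * R)) :
  (forall p, A p -> exists2 r : R, 0 < r & forall p' : R * R,
    `|p'.1 - p.1| < r -> `|p'.2 - p.2| < r -> A p') -> measurable A.
Proof.
move=> hA.
pose box (q1 q2 : rat) (n : nat) : set (R * R) :=
  ball (ratr q1 : R) n.+1%:R^-1 `*` ball (ratr q2 : R) n.+1%:R^-1.
pose C (q1 q2 : rat) (n : nat) : set (R * R) :=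
  if pselect (box q1 q2 n `<=` A) then box q1 q2 n else set0.
have -> : A = \bigcup_q1 \bigcup_q2 \bigcup_n C q1 q2 n.
  apply/seteqP; split => [p Ap|p [q1 _ [q2 _ [n _]]]]; last first.
    by rewrite /C; case: (pselect (box q1 q2 n `<=` A)) => // h; exact: h.
  have [r r0 hr] := hA _ Ap.
  have [n] : exists n : nat, n.+1%:R^-1 < r / 2.
    have r2 : 0 < r / 2 by rewrite divr_gt0.
    exists (Num.bound (r / 2)^-1); rewrite invf_plt ?posrE//.
    by rewrite (lt_trans (archi_boundP _))// ?ltr_nat// invr_ge0 ltW.
  move=> nr.
  have n0 : 0 < n.+1%:R^-1 :> R by rewrite invr_gt0.
  have near_rat (x : R) : exists q : rat, `|x - ratr q| < n.+1%:R^-1.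
    have xl : x - n.+1%:R^-1 < x by rewrite ltrBlDr ltrDl.
    have [q] := rat_in_itvoo xl.
    rewrite in_itv/= => /andP[h1 h2]; exists q.
    by rewrite ger0_norm ?subr_ge0 ?ltW// ltrBlDr -ltrBlDl.
  have [q1 h1] := near_rat p.1; have [q2 h2] := near_rat p.2.
  exists q1 => //; exists q2 => //; exists n => //.
  rewrite /C; case: (pselect (box q1 q2 n `<=` A)) => [?|[]]/=.
    by split; rewrite /ball/= distrC.
  move=> p' [/=]; rewrite /ball/= => b1 b2.
  apply: hr.
    rewrite -(subrK (ratr q1) p'.1) -addrA (le_lt_trans (ler_normD _ _))//.
    by rewrite (splitr r) ltrD// distrC; exact: lt_trans nr.
  rewrite -(subrK (ratr q2) p'.2) -addrA (le_lt_trans (ler_normD _ _))//.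
  by rewrite (splitr r) ltrD// distrC; exact: lt_trans nr.
apply: bigcupT_measurable_rat => q1; apply: bigcupT_measurable_rat => q2.
apply: bigcupT_measurable => n; rewrite /C; case: (pselect (box q1 q2 n `<=` A)) => //= ?.
by apply: measurableX; exact: measurable_ball.
Qed.

Lemma measurable_fun_of_rays d (T : measurableType d) (D : set T) (f : T -> R) :
  (forall a, measurable (D `&` [set x | a < f x])) -> measurable_fun D f.
Proof.
move=> H; apply: (measurability _ (RGenOInfty.measurableE R)).
by move=> _ [_ [a ->]] <-; rewrite preimage_itvoy.
Qed.

(** An integrable function cannot exceed 1 on a whole set of infinite measure. *)
Lemma exists_le1_of_integrable (g : R -> \bar R) (S : set R) : measurable S -> mu S = +oo%E ->
  measurable_fun setT g -> (forall x, 0 <= g x)%E ->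
  (\int[mu]_x g x < +oo)%E -> exists2 s, S s & (g s <= 1)%E.
Proof.
move=> mS muS mg g0 gfin; apply: contrapT => no.
suff : (\int[mu]_x g x = +oo)%E by move=> h; rewrite h in gfin.
apply/eqP; rewrite -leye_eq -[X in (X <= _)%E]mul1e -muS -integral_cst//.
apply: (@le_trans _ _ (\int[mu]_(x in S) g x)%E); last first.
  exact: ge0_subset_integral.
apply: ge0_le_integral => //.
- exact: measurable_funTS.
- by move=> x Sx; rewrite leNgt; apply/negP => gx1; apply: no; exists x => //; exact: ltW.
Qed.

End real_integrals.


(** * The Poisson bound on vertical lines *)

Section cauchy_kernel.
Context {R : realType}.
Variables (F : R[i]^o -> R[i]^o) (c : R[i]) (x0 h y : R).
Hypothesis hF : analytic_Cplus F.
Hypotheses (x0_gt0 : 0 < x0) (h_gt0 : 0 < h).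

Let z : R[i] := ((x0 + h) +i* y)%C.
Let z' : R[i] := ((x0 - h) +i* y)%C.

(** The integrand of the contour argument.  The factor [1 / (w - z')], with [z'] the
    mirror image of [z] in the line [Re w = x0], turns the Cauchy kernel into the
    Poisson kernel on that line and makes it decay quadratically at infinity.
    Subtracting [F z] removes the pole. *)
Definition cauchy_int (w : R[i]) : R[i] :=
  c * (F w - F z) * ((w - z) * (w - z'))^-1.

Lemma cauchy_int_cdiff w : x0 <= complex.Re w -> w != z -> cdiff cauchy_int w.
Proof.
move=> xw wz; apply: derivable_cdiff.
have wz' : w != z'.
  by apply/eqP => E; move: xw; rewrite E /= leNgt ltrBlDr ltrDl h_gt0.
have dF : derivable F w 1 by apply: hF; rewrite /Cplus/= (lt_le_trans x0_gt0).
pose V := R[i]^o.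
have d1 : derivable ((cst (c : V) : V -> V) * (F - cst (F z))) w 1.
  apply: (@derivableM _ _ (cst (c : V))); first exact: derivable_cst.
  by apply: (@derivableB _ _ _ F); [exact: dF|exact: derivable_cst].
have dB (u : V) : derivable ((id : V -> V) - cst u) w 1.
  by apply: (@derivableB _ _ _ id); [exact: derivable_id|exact: derivable_cst].
have d2 : derivable (((id : V -> V) - cst (z : V)) * (id - cst (z' : V))) w 1.
  exact: (derivableM (dB z) (dB z')).
pose den : V -> V := (id - cst (z : V)) * (id - cst (z' : V)).
have nz : den w != 0 by rewrite mulf_neq0// subr_eq0.
have d3 : derivable (fun v => (den v)^-1) w 1.
  by apply: (@derivableV _ _ den) => //; exact: d2.
have d4 := derivableM d1 d3.
have -> : (cauchy_int : V -> V) = (cst (c : V) * (F - cst (F z))) * (fun v => (den v)^-1).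
  by apply/funext => v.
exact: d4.
Qed.

(** To the right of the line [Re w = x0], a point is closer to [z] than to its
    mirror image. *)
Lemma cauchy_den_ge w : x0 <= complex.Re w ->
  cmod (w - z) ^+ 2 <= cmod ((w - z) * (w - z')).
Proof.
move=> xw; rewrite cmodM expr2 ler_wpM2l ?cmod_ge0//.
rewrite -(ler_pXn2r (n := 2)) ?nnegrE ?cmod_ge0// !cmod_sqr.
rewrite /z /z' !cReB !cImB /= lerD2r -subr_ge0.
have -> : (complex.Re w - (x0 - h)) ^+ 2 - (complex.Re w - (x0 + h)) ^+ 2 =
  4 * ((complex.Re w - x0) * h) by ring.
by rewrite mulr_ge0// mulr_ge0 ?subr_ge0// ltW.
Qed.

(** The modulus of [F w] is bounded by [1 + |F w|^2], since only the mean square of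
    [F] on lines is controlled. *)
Lemma cauchy_int_le w (D : R) : x0 <= complex.Re w -> 0 < D ->
  D <= cmod (w - z) ^+ 2 ->
  cmod (cauchy_int w) <= cmod c * (1 + cmod (F z) + cmod (F w) ^+ 2) * D^-1.
Proof.
move=> xw D0 DD; rewrite /cauchy_int !cmodM.
have cD : D <= cmod ((w - z) * (w - z')).
  exact: le_trans DD (cauchy_den_ge xw).
apply: ler_pM.
- by rewrite mulr_ge0// cmod_ge0.
- exact: cmod_ge0.
- rewrite ler_wpM2l ?cmod_ge0// (le_trans (cmodD _ _))// cmodN.
  set a := cmod (F w); set b := cmod (F z).
  have : 0 <= (a - 1) ^+ 2 by exact: sqr_ge0.
  have : 0 <= a by exact: cmod_ge0.
  by rewrite sqrrB; lra.
- by rewrite cmodV lef_pV2 ?posrE//; exact: lt_le_trans cD.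
Qed.

Lemma cauchy_int_near : exists2 r : R, 0 < r &
  exists M, forall w, cmod (w - z) < r -> cmod (cauchy_int w) <= M.
Proof.
have : cdiff F z.
  by apply: derivable_cdiff; apply: hF; rewrite /Cplus/= addr_gt0.
move=> [L HL]; have [d d0 Hd] := HL 1 ltr01.
exists (Num.min d h); first by rewrite lt_min d0.
exists (cmod c * (1 + cmod L) * h^-1) => w; rewrite lt_min => /andP[wd wh].
have L1 : 0 <= 1 + cmod L by rewrite addr_ge0// cmod_ge0.
have [->|wz] := eqVneq w z.
  by rewrite /cauchy_int subrr mulr0 mul0r cmod0 !mulr_ge0 ?cmod_ge0// invr_ge0 ltW.
have wz0 : 0 < cmod (w - z) by rewrite cmod_gt0 subr_eq0.
have hz' : h <= cmod (w - z').
  have := le_lt_trans (norm_Re_le (w - z)) wh.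
  rewrite ltr_norml => /andP[h2 _].
  apply: le_trans (norm_Re_le (w - z')); rewrite (le_trans _ (ler_norm _))//.
  by move: h2; rewrite /z /z' !cReB /=; lra.
have Fw : cmod (F w - F z) <= (1 + cmod L) * cmod (w - z).
  rewrite -(subrK (L * (w - z)) (F w - F z)).
  rewrite (le_trans (cmodD _ _))// [leRHS]mulrDl -cmodM lerD//.
  by rewrite mul1r (le_trans (Hd _ wd))// mul1r.
rewrite /cauchy_int !cmodM cmodV cmodM -!mulrA ler_wpM2l ?cmod_ge0//.
rewrite ler_pdivrMr; last by rewrite mulr_gt0// (lt_le_trans h_gt0).
apply: (le_trans Fw); rewrite -!mulrA ler_wpM2l//.
rewrite mulrCA -[leLHS]mulr1 ler_pM2l// mulrC -ler_pdivrMr ?invr_gt0//.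
by rewrite mul1r invrK.
Qed.

(** On the line [Re w = x0] the kernel is real, equal to minus [lorentz h y]. *)
Lemma cauchy_int_left t : complex.Im (cauchy_int (x0 +i* t)%C) =
  lorentz h y t * (complex.Im (c * F z) - complex.Im (c * F (x0 +i* t)%C)).
Proof.
have -> : cauchy_int (x0 +i* t)%C =
    (lorentz h y t)%:C%C * (c * F z - c * F (x0 +i* t)%C).
  have E : ((x0 +i* t)%C - z) * ((x0 +i* t)%C - z') =
      - (h ^+ 2 + (t - y) ^+ 2)%:C%C.
    rewrite /z /z'; apply/eqP; rewrite eq_complex /=; apply/andP; split;
    by apply/eqP; ring.
  have gen (u v p q : R[i]) : u * (v - p) * (- q) = q * (u * p - u * v) by ring.
  by rewrite /cauchy_int E invrN gen /lorentz fmorphV.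
have iE (r : R) : complex.Im r%:C%C = 0 by [].
have rE (r : R) : complex.Re r%:C%C = r by [].
by rewrite [LHS]cImM iE rE mul0r addr0 cImB.
Qed.

End cauchy_kernel.

Section strip_tonelli.
Context {R : realType}.
Notation mu := (@lebesgue_measure R).
Variable F : R[i]^o -> R[i]^o.
Hypothesis hF : analytic_Cplus F.

Lemma analytic_cdiff w : 0 < complex.Re w -> cdiff F w.
Proof. by move=> w0; apply: derivable_cdiff; exact: hF. Qed.

Lemma sqr_cmod_close w (e : R) : 0 < complex.Re w -> 0 < e -> exists2 d : R, 0 < d &
  forall w', cmod (w' - w) < d -> `|cmod (F w') ^+ 2 - cmod (F w) ^+ 2| < e.
Proof.
move=> w0 e0.
pose a := cmod (F w).
have a0 : 0 <= a by exact: cmod_ge0.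
have A0 : 0 < 2 * a + 1 by rewrite ltr_wpDl// mulr_ge0.
have m0 : 0 < Num.min 1 (e / (2 * a + 1)) by rewrite lt_min ltr01 divr_gt0.
have [d d0 Hd] := cdiff_cont (analytic_cdiff w0) m0.
exists d => // w' /Hd; rewrite lt_min => /andP[h1].
rewrite ltr_pdivlMr// => h2.
set b := cmod (F w').
have b0 : 0 <= b by exact: cmod_ge0.
have t1 : b <= cmod (F w' - F w) + a by have := cmodD (F w' - F w) (F w); rewrite subrK.
have t2 : a <= cmod (F w' - F w) + b.
  by have := cmodD (F w - F w') (F w'); rewrite subrK cmodB.
have ba : `|b - a| <= cmod (F w' - F w).
  by rewrite ler_norml; lra.
rewrite -/a -/b subr_sqr normrM (le_lt_trans _ h2)//.
apply: ler_pM => //; rewrite ger0_norm ?addr_ge0//.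
by lra.
Qed.

Lemma sqr_cmod_cont_x (x s : R) : 0 < x ->
  {for x, continuous (fun x => cmod (F (x +i* s)%C) ^+ 2)}.
Proof.
move=> x_gt0; apply/cvgrPdist_lt => e e0.
have [d d0 Hd] := @sqr_cmod_close (x +i* s)%C _ x_gt0 e0.
near=> t; rewrite distrC; apply: Hd.
rewrite (le_lt_trans (cmod_le_ReIm _))//= subrr normr0 addr0.
by near: t; apply: cvgr_distC_lt.
Unshelve. all: by end_near. Qed.

Lemma sqr_cmod_cont_y (x s : R) : 0 < x ->
  {for s, continuous (fun s => cmod (F (x +i* s)%C) ^+ 2)}.
Proof.
move=> x_gt0; apply/cvgrPdist_lt => e e0.
have [d d0 Hd] := @sqr_cmod_close (x +i* s)%C _ x_gt0 e0.
near=> t; rewrite distrC; apply: Hd.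
rewrite (le_lt_trans (cmod_le_ReIm _))//= subrr normr0 add0r.
by near: t; apply: cvgr_distC_lt.
Unshelve. all: by end_near. Qed.

Lemma sqr_cmod_meas_y (x : R) : 0 < x ->
  measurable_fun setT (fun s => cmod (F (x +i* s)%C) ^+ 2).
Proof.
by move=> x0; apply: continuous_measurable_fun => s; exact: sqr_cmod_cont_y.
Qed.

Lemma sqr_cmod_meas : measurable_fun [set p : R * R | 0 < p.1]
  (fun p : R * R => cmod (F (p.1 +i* p.2)%C) ^+ 2).
Proof.
apply: measurable_fun_of_rays => a; apply: measurable_of_boxes => p [/= p0 ap].
have e0 : 0 < cmod (F (p.1 +i* p.2)%C) ^+ 2 - a by rewrite subr_gt0.
have [d d0 Hd] := @sqr_cmod_close (p.1 +i* p.2)%C _ p0 e0.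
exists (Num.min (d / 2) p.1); first by rewrite lt_min p0 divr_gt0.
move=> p'; rewrite !lt_min => /andP[h1 h1'] /andP[h2 _]; split => /=.
  by move: h1'; rewrite ltr_norml; lra.
have := Hd (p'.1 +i* p'.2)%C; rewrite ltr_norml => /(_ _)/andP[].
  by rewrite (le_lt_trans (cmod_le_ReIm _))//= (splitr d) ltrD.
by lra.
Qed.

(** The integrals of [|F|^2] along the horizontal segments of a strip are
    integrable in the height, by Tonelli's theorem and the bound on vertical
    lines. *)
Lemma strip_tonelli (M2 x0 X : R) : 0 < x0 -> x0 <= X ->
  (forall x : R, 0 < x -> (\int[mu]_s (cmod (F (x +i* s)%C) ^+ 2)%:E <= M2%:E)%E) ->
  exists g : R -> \bar R, [/\ measurable_fun setT g, (forall s, 0 <= g s)%E,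
    (\int[mu]_s g s < +oo)%E &
    forall s, g s = (\int[mu]_(x in `[x0, X]) (cmod (F (x +i* s)%C) ^+ 2)%:E)%E].
Proof.
move=> x0_gt0 x0X hM.
pose D : set (R * R) := `[x0, X]%classic `*` setT.
have mD : measurable D by apply: measurableX => //; exact: measurable_itv.
pose k (p : R * R) := (cmod (F (p.1 +i* p.2)%C) ^+ 2)%:E.
pose f := k \_ D.
have mf : measurable_fun setT f.
  apply/(measurable_restrictT k mD).
  apply: (@measurable_funS _ _ _ _ [set p : R * R | 0 < p.1]).
  - rewrite (_ : [set p | _] = `]0, +oo[%classic `*` setT).
      by apply: measurableX => //; exact: measurable_itv.
    by apply/seteqP; split => p /=; rewrite in_itv/= andbT; [split|case].
  - by move=> p [/= ]; rewrite in_itv/= => /andP[h _] _; exact: lt_le_trans h.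
  - by apply/measurable_EFinP; exact: sqr_cmod_meas.
have f0 p : (0 <= f p)%E by apply: erestrict_ge0 => q _; rewrite lee_fin sqr_ge0.
pose g s := (\int[mu]_x f (x, s))%E.
have fE x s : f (x, s) = if x \in `[x0, X] then k (x, s) else 0%E.
  rewrite /f patchE; have -> // : ((x, s) \in D) = (x \in `[x0, X]).
  apply/idP/idP; first by rewrite inE => -[].
  by rewrite inE => h; split.
exists g; split.
- exact: (measurable_fun_fubini_tonelli_G (m1 := mu) f mf f0).
- by move=> s; exact: integral_ge0.
- have <- := fubini_tonelli (m1 := mu) (m2 := mu) f mf f0.
  apply: (@le_lt_trans _ _ (\int[mu]_(x in `[x0, X]) M2%:E)%E); last first.
    rewrite integral_cst//= lebesgue_measure_itv/=.
    by case: ifP => _; rewrite ?mule0 ?ltry// -EFinD -EFinM ltry.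
  rewrite [leRHS]integral_mkcond.
  apply: ge0_le_integral => //.
  + by move=> x _; exact: integral_ge0.
  + exact: (measurable_fun_fubini_tonelli_F (m2 := mu) f mf f0).
  + by apply/(measurable_restrictT _ _).1 => //; exact: measurable_itv.
  + move=> x _; rewrite patchE mem_setE; under eq_integral do rewrite fE.
    case: ifPn => xI; last by rewrite integral0.
    by apply: hM; move: xI; rewrite in_itv/= => /andP[h _]; exact: lt_le_trans h.
- move=> s; rewrite /g [RHS]integral_mkcond; apply: eq_integral => x _.
  by rewrite fE patchE mem_setE.
Qed.

(** Supplies the horizontal sides of the contour: no pointwise decay of [F] is
    available, but the mean square of [F] is at most 1 on some horizontal segments
    arbitrarily far away. *)
Lemma exists_good_height (M2 x0 X : R) : 0 < x0 -> x0 <= X ->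
  (forall x : R, 0 < x -> (\int[mu]_s (cmod (F (x +i* s)%C) ^+ 2)%:E <= M2%:E)%E) ->
  forall S : set R, measurable S -> mu S = +oo%E ->
  exists2 s, S s & seg (fun x => cmod (F (x +i* s)%C) ^+ 2) x0 X <= 1.
Proof.
move=> x0_gt0 x0X hM S mS muS.
have [g [mg g0 gfin gE]] := strip_tonelli x0_gt0 x0X hM.
have [s Ss gs] := exists_le1_of_integrable mS muS mg g0 gfin.
exists s => //; rewrite -lee_fin -seg_EFin -?gE//.
move=> x /andP[hx _]; apply: sqr_cmod_cont_x; exact: lt_le_trans hx.
Qed.

End strip_tonelli.

Section poisson.
Context {R : realType}.
Notation mu := (@lebesgue_measure R).

Lemma cont_on_lin (f g : R -> R) (a b l r : R) : cont_on f l r -> cont_on g l r ->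
  cont_on (fun x => a * f x + b * g x) l r.
Proof.
move=> cf cg x hx; apply: cvgD; apply: cvgM; try exact: cvg_cst.
  exact: cf.
exact: cg.
Qed.

Lemma seg_lin (f g : R -> R) (a b l r : R) : cont_on f l r -> cont_on g l r ->
  seg (fun x => a * f x + b * g x) l r = a * seg f l r + b * seg g l r.
Proof.
move=> cf cg.
have iZ k (u : R -> R) : cont_on u l r ->
    mu.-integrable `[l, r] (EFin \o (fun x => k * u x)).
  move=> cu; apply: cont_on_integrable => x hx.
  by apply: cvgM; [exact: cvg_cst|exact: cu].
rewrite /seg RintegralD//; try exact: iZ.
by rewrite !RintegralZl//; exact: cont_on_integrable.
Qed.

Lemma seg_norm_le (f g : R -> R) (l r : R) : cont_on f l r -> cont_on g l r ->
  (forall x, l <= x <= r -> `|f x| <= g x) -> `|seg f l r| <= seg g l r.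
Proof.
move=> cf cg fg; rewrite ler_norml; apply/andP; split; last first.
  by apply: le_seg => // x /fg; apply: le_trans; exact: ler_norm.
have -> : - seg g l r = (-1) * seg g l r + 0 * seg g l r.
  by rewrite mulN1r mul0r addr0.
rewrite -seg_lin//; apply: le_seg => //; first exact: cont_on_lin.
by move=> x /fg; rewrite mulN1r mul0r addr0 ler_norml => /andP[].
Qed.

Lemma seg_le_integral (f : R -> R) (l r : R) : measurable_fun setT f ->
  cont_on f l r -> (forall x, 0 <= f x) ->
  ((seg f l r)%:E <= \int[mu]_x (f x)%:E)%E.
Proof.
move=> mf cf f0; rewrite -seg_EFin//; apply: ge0_subset_integral => //.
- exact/measurable_EFinP.
- by move=> x _; rewrite lee_fin.
Qed.

(** Rotating [F] reduces a bound on the modulus of [F z] to the imaginary part, the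
    only one seen by the left side of [re_contour]. *)
Lemma exists_rotation (v : R[i]) : exists2 u : R[i],
  cmod u = 1 & complex.Im (u * v) = cmod v.
Proof.
have [->|v0] := eqVneq v 0.
  by exists 1; rewrite ?mulr0 ?cmod0// /cmod ComplexField.Normc.normc1.
have n0 : cmod v != 0 by rewrite cmod_eq0.
exists ((complex.Im v / cmod v) +i* (complex.Re v / cmod v))%C.
  apply/eqP; rewrite -(@eqrXn2 _ 2)// ?cmod_ge0// expr1n cmod_sqr /=.
  by rewrite !expr_div_n -mulrDl addrC -cmod_sqr divff// expf_neq0.
rewrite cImM /=; set m := cmod v in n0 *; set p := complex.Re v; set q := complex.Im v.
have -> : q / m * q + p / m * p = (p ^+ 2 + q ^+ 2) / m by ring.
by rewrite -cmod_sqr -/m expr2 mulfK.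
Qed.

Variable F : R[i]^o -> R[i]^o.
Hypothesis hF : analytic_Cplus F.

Lemma cmod_cont_y (x s : R) : 0 < x ->
  {for s, continuous (fun s => cmod (F (x +i* s)%C))}.
Proof.
move=> x0.
have -> : (fun s => cmod (F (x +i* s)%C)) =
    (@Num.sqrt R) \o (fun s => cmod (F (x +i* s)%C) ^+ 2).
  by apply/funext => t /=; rewrite sqrtr_sqr ger0_norm// cmod_ge0.
apply: continuous_comp; first exact: sqr_cmod_cont_y.
exact: sqrt_continuous.
Qed.

(** The right side of the contour: as [X] grows, the first term is of order
    [1 / X] and the second of order [1 / X^2], uniformly in the height of the
    contour. *)
Lemma cauchy_int_vert_le (c : R[i]) (x0 h y X : R) :
  0 < x0 -> 0 < h -> x0 + h < X ->
  forall (M2 l r : R), l <= r ->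
  (\int[mu]_s (cmod (F (X +i* s)%C) ^+ 2)%:E <= M2%:E)%E ->
  `|seg (fun s => complex.Im (cauchy_int F c x0 h y (X +i* s)%C)) l r| <=
  cmod c * (1 + cmod (F ((x0 + h) +i* y)%C)) * (pi / (X - (x0 + h))) +
  cmod c * ((X - (x0 + h)) ^- 2) * M2.
Proof.
move=> x0_gt0 h_gt0 hX M2 l r lr hM.
have D0 : 0 < X - (x0 + h) by rewrite subr_gt0.
have x0X : x0 < X by rewrite (lt_trans _ hX)// ltrDl.
have X0 : 0 < X by rewrite (lt_trans x0_gt0).
set A := 1 + _; set D := X - _ in D0 *.
have A0 : 0 <= A by rewrite addr_ge0// cmod_ge0.
have cq : cont_on (fun s => cmod (F (X +i* s)%C) ^+ 2) l r.
  by move=> s _; exact: sqr_cmod_cont_y.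
have cl : cont_on (lorentz D y) l r by move=> s _; exact: lorentz_cont.
apply: (@le_trans _ _ (seg (fun s => (cmod c * A) * lorentz D y s +
    (cmod c * D ^- 2) * cmod (F (X +i* s)%C) ^+ 2) l r)).
  apply: seg_norm_le.
  - move=> s _; apply: cdiff_cont_line_y; apply: cauchy_int_cdiff => //=.
      exact: ltW.
    by apply/eqP => -[/eqP]; rewrite gt_eqF.
  - exact: cont_on_lin.
  - move=> s _; rewrite (le_trans (norm_Im_le _))//.
    have := @cauchy_int_le _ F c x0 h y h_gt0 (X +i* s)%C _ (ltW x0X) (lorentz_den_gt0 y s D0).
    rewrite cmod_sqr /= lexx => /(_ erefl); rewrite -/A => /le_trans; apply.
    rewrite [cmod c * (_ + _)]mulrDr mulrDl lerD// -!mulrA ler_wpM2l ?cmod_ge0//.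
    rewrite [leLHS]mulrA -expr2 [leRHS]mulrC ler_wpM2l ?sqr_ge0// lef_pV2 ?posrE ?lorentz_den_gt0 ?exprn_gt0//.
    by rewrite lerDl sqr_ge0.
rewrite seg_lin// lerD// ler_wpM2l//.
- by rewrite mulr_ge0 ?cmod_ge0.
- exact: seg_lorentz.
- by rewrite mulr_ge0 ?cmod_ge0// invr_ge0 exprn_ge0// ltW.
- rewrite -lee_fin; apply: le_trans hM; apply: seg_le_integral => //.
  + exact: sqr_cmod_meas_y.
  + by move=> s; rewrite sqr_ge0.
Qed.

(** The horizontal sides of the contour, at distance at least [T] from [z]. *)
Lemma cauchy_int_hor_le (c : R[i]) (x0 h y X s T : R) :
  0 < x0 -> 0 < h -> x0 <= X -> 0 < T -> T <= `|s - y| ->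
  seg (fun x => cmod (F (x +i* s)%C) ^+ 2) x0 X <= 1 ->
  `|seg (fun x => complex.Re (cauchy_int F c x0 h y (x +i* s)%C)) x0 X| <=
  cmod c * ((1 + cmod (F ((x0 + h) +i* y)%C)) * (X - x0) + 1) * T ^- 2.
Proof.
move=> x0_gt0 h_gt0 x0X T0 Ts hs.
set A := 1 + _.
have A0 : 0 <= A by rewrite addr_ge0// cmod_ge0.
have cq : cont_on (fun x => cmod (F (x +i* s)%C) ^+ 2) x0 X.
  by move=> x /andP[hx _]; apply: (sqr_cmod_cont_x hF); exact: lt_le_trans hx.
have c1 : cont_on (fun=> 1) x0 X by exact: cst_cont_on.
apply: (@le_trans _ _ (seg (fun x => (cmod c * A * T ^- 2) * 1 +
    (cmod c * T ^- 2) * cmod (F (x +i* s)%C) ^+ 2) x0 X)).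
  apply: seg_norm_le.
  - move=> x /andP[hx _]; apply: cdiff_cont_line_x; apply: cauchy_int_cdiff => //=.
    apply/eqP => -[_ sy]; move: Ts; rewrite sy subrr normr0.
    by rewrite leNgt T0.
  - exact: cont_on_lin.
  - move=> x /andP[hx _]; rewrite (le_trans (norm_Re_le _))//.
    have := @cauchy_int_le _ F c x0 h y h_gt0 (x +i* s)%C (T ^+ 2) hx.
    rewrite exprn_gt0// cmod_sqr /= => /(_ erefl); rewrite -/A => H.
    apply: (le_trans (H _)).
      rewrite (@le_trans _ _ ((s - y) ^+ 2))// ?lerDr ?sqr_ge0//.
      rewrite -[leRHS]real_normK ?num_real//.
      by rewrite ler_pXn2r// nnegrE// ltW.
    by rewrite le_eqVlt; apply/orP; left; apply/eqP; ring.
rewrite seg_lin// seg_cst// mul1r.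
have -> : cmod c * (A * (X - x0) + 1) * T ^- 2 =
  cmod c * A * T ^- 2 * (X - x0) + cmod c * T ^- 2 * 1 by ring.
by rewrite lerD2l ler_wpM2l// mulr_ge0 ?cmod_ge0// invr_ge0 exprn_ge0// ltW.
Qed.

End poisson.

Section poisson_bound.
Context {R : realType}.
Notation mu := (@lebesgue_measure R).

Lemma invXn2_le (T : R) : 1 <= T -> T ^- 2 <= T^-1.
Proof.
move=> T1; have T0 : 0 < T by exact: lt_le_trans T1.
rewrite lef_pV2 ?posrE ?exprn_gt0// expr2 -[leLHS]mulr1.
by rewrite ler_wpM2l// ltW.
Qed.

Lemma div_le_of_le (B e T : R) : 0 < e -> 0 < T -> B / e <= T -> B / T <= e.
Proof.
by move=> e0 T0; rewrite !ler_pdivrMr// mulrC.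
Qed.

(** [F] at [z] is bounded by the Poisson integral of its modulus on a vertical
    line (up to the factor [pi], as the total mass of the kernel is bounded below
    by its mass on the interval of half-length [h] only). *)
Lemma poisson_bound (F : R[i]^o -> R[i]^o) (M2 x0 h y : R) :
  analytic_Cplus F -> 0 < x0 -> 0 < h ->
  (forall x : R, 0 < x ->
     (\int[mu]_s (cmod (F (x +i* s)%C) ^+ 2)%:E <= M2%:E)%E) ->
  ((cmod (F ((x0 + h) +i* y)%C))%:E <=
    \int[mu]_t (h * (lorentz h y t * cmod (F (x0 +i* t)%C)))%:E)%E.
Proof.
move=> hF x0_gt0 h_gt0 hM.
set z := ((x0 + h) +i* y)%C.
have ckF l r : cont_on (fun t => lorentz h y t * cmod (F (x0 +i* t)%C)) l r.
  by move=> t _; apply: cvgM; [exact: lorentz_cont|exact: cmod_cont_y].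
have mkF : measurable_fun setT (fun t => h * (lorentz h y t * cmod (F (x0 +i* t)%C))).
  apply: continuous_measurable_fun => t; apply: cvgM; first exact: cvg_cst.
  by apply: cvgM; [exact: lorentz_cont|exact: cmod_cont_y].
apply/lee_addgt0Pr => e' e'0.
pose e := e' / (3 * h).
have e0 : 0 < e by rewrite divr_gt0// mulr_gt0.
have [u u1 uF] := exists_rotation (F z).
pose A := 1 + cmod (F z).
have A0 : 0 <= A by rewrite addr_ge0// cmod_ge0.
(* The distance [D] of the right side and the minimal distance [T] of the
   horizontal sides are chosen to make each of their contributions at most
   [e]. *)
pose D := 1 + (A * pi + `|M2|) / e.
have D1 : 1 <= D.
  rewrite lerDl; apply: divr_ge0; last exact: ltW.
  by rewrite addr_ge0// mulr_ge0// pi_ge0.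
have D0 : 0 < D by exact: lt_le_trans D1.
pose X := x0 + h + D.
have hX : x0 + h < X by rewrite ltrDl.
have XD : X - (x0 + h) = D by rewrite /X addrC addKr.
have x0X : x0 <= X by rewrite /X -addrA lerDl addr_ge0// ltW.
have X0 : 0 < X by exact: lt_le_trans x0X.
pose B := A * (X - x0) + 1.
have B0 : 0 <= B by rewrite addr_ge0// mulr_ge0// subr_ge0.
pose T := 1 + h + B / e.
have Be0 : 0 <= B / e by rewrite divr_ge0// ltW.
have T1 : 1 <= T by rewrite /T -addrA lerDl addr_ge0// ltW.
have Th : h <= T by rewrite /T addrAC lerDr addr_ge0.
have T0 : 0 < T by exact: lt_le_trans T1.
have [|d] := exists_good_height hF x0_gt0 x0X hM (S := `[y + T, +oo[%classic)
  (measurable_itv _).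
  by rewrite lebesgue_measure_itv/= ltry.
rewrite /= in_itv/= andbT => yd hd.
have [|b] := exists_good_height hF x0_gt0 x0X hM (S := `]-oo, y - T]%classic)
  (measurable_itv _).
  by rewrite lebesgue_measure_itv/= ltNyr.
rewrite /= in_itv/= => yb hb.
have yTd : y + h <= d by apply: le_trans yd; rewrite lerD2l.
have yTb : b <= y - h by apply: (le_trans yb); rewrite lerD2l lerN2.
have yhh : y - h <= y + h by rewrite lerD2l (le_trans _ (ltW h_gt0))// oppr_le0 ltW.
have bd : b <= d by rewrite (le_trans yTb)// (le_trans yhh).
have by_ : b < y by rewrite (le_lt_trans yTb)// ltrBlDr ltrDl.
have yd_ : y < d by rewrite (lt_le_trans _ yTd)// ltrDl.
pose G := cauchy_int F u x0 h y.
have dG w : x0 <= complex.Re w -> w != z -> cdiff G w by exact: cauchy_int_cdiff.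
have [r r0 [M GM]] := cauchy_int_near u y hF x0_gt0 h_gt0.
have x0p : x0 < x0 + h < X by rewrite ltrDl h_gt0.
have ybd : b < y < d by rewrite by_.
have J0 : re_contour G x0 X b d = 0.
  apply: (@goursat_punctured R G x0 X b d (x0 + h) y M r) => //.
  move=> x t /andP[hx _] _ xt; apply: dG => //.
  by apply/eqP => -[xE tE]; apply: xt; rewrite xE tE.
have hc s : s != y -> cdiff_hline G x0 X s.
  move=> sy x /andP[hx _]; apply: dG => //.
  by apply/eqP => -[_ /eqP]; apply/negP.
have vc x : x0 <= x -> x != x0 + h -> cdiff_vline G b d x.
  move=> hx xy s _; apply: dG => //.
  by apply/eqP => -[/eqP + _]; apply/negP.
have hb' : cdiff_hline G x0 X b by apply: hc; rewrite lt_eqF.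
have hd' : cdiff_hline G x0 X d by apply: hc; rewrite gt_eqF.
have vx : cdiff_vline G b d x0 by apply: vc => //; rewrite lt_eqF// ltrDl.
have vX : cdiff_vline G b d X by apply: vc => //; rewrite gt_eqF.
move: J0; rewrite re_contourE//.
have bdX : `|seg (fun s => complex.Im (G (X +i* s)%C)) b d| <= e.
  have := @cauchy_int_vert_le R F hF u x0 h y X x0_gt0 h_gt0 hX M2 b d bd (hM _ X0).
  rewrite XD u1 !mul1r -/z -/A => /le_trans; apply.
  apply: le_trans (_ : (A * pi + `|M2|) / D <= e); last first.
    by apply: div_le_of_le => //; rewrite /D lerDr.
  rewrite [leRHS]mulrDl [A * (pi / D)]mulrA lerD2l mulrC.
  apply: (@le_trans _ _ (`|M2| * D ^- 2)).
    by rewrite ler_wpM2r ?ler_norm// invr_ge0 exprn_ge0// ltW.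
  by rewrite ler_wpM2l// invXn2_le.
have bdh s : T <= `|s - y| -> seg (fun x => cmod (F (x +i* s)%C) ^+ 2) x0 X <= 1 ->
    `|seg (fun x => complex.Re (G (x +i* s)%C)) x0 X| <= e.
  move=> Ts hs.
  have := @cauchy_int_hor_le R F hF u x0 h y X s T x0_gt0 h_gt0 x0X T0 Ts hs.
  rewrite u1 !mul1r -/z -/A -/B => /le_trans; apply.
  apply: le_trans (_ : B / T <= e); last first.
    by apply: div_le_of_le => //; rewrite /T lerDr addr_ge0// ltW.
  by rewrite ler_wpM2l// invXn2_le.
have bdd := bdh d _ hd; have bdb := bdh b _ hb.
have {bdd} : `|seg (fun x => complex.Re (G (x +i* d)%C)) x0 X| <= e.
  by apply: bdd; rewrite (le_trans _ (ler_norm _))// lerBrDl.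
have {bdb} : `|seg (fun x => complex.Re (G (x +i* b)%C)) x0 X| <= e.
  by apply: bdb; rewrite distrC (le_trans _ (ler_norm _))// lerBrDl -lerBrDr.
move: bdX; rewrite !ler_norml.
have low : cmod (F z) * seg (lorentz h y) b d
    - seg (fun t => lorentz h y t * cmod (F (x0 +i* t)%C)) b d <=
    seg (fun s => complex.Im (G (x0 +i* s)%C)) b d.
  have cl : cont_on (lorentz h y) b d by move=> t _; exact: lorentz_cont.
  rewrite -[X in _ - X]mul1r -mulNr -seg_lin//.
  apply: le_seg; [exact: cont_on_lin|exact: cdiff_vline_cont|move=> t _].
  rewrite /G cauchy_int_left// -/z uF mulrBr mulN1r [cmod (F z) * _]mulrC.
  rewrite lerD2l lerN2 ler_wpM2l//; first by rewrite ltW// lorentz_gt0.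
  by rewrite (le_trans (ler_norm _))// (le_trans (norm_Im_le _))// cmodM u1 mul1r.
(* On [[y - h, y + h]] the Lorentzian is at least [1 / (2 h^2)]. *)
have lowl : h^-1 <= seg (lorentz h y) b d.
  apply: (@le_trans _ _ (seg (lorentz h y) (y - h) (y + h))); last first.
    rewrite -lee_fin -!seg_EFin; try by move=> t _; exact: lorentz_cont.
    apply: ge0_subset_integral => //.
    - apply/measurable_EFinP; apply: measurable_funTS; exact: lorentz_meas.
    - by move=> t _; rewrite lee_fin ltW// lorentz_gt0.
    - by apply: subset_itv; rewrite bnd_simp.
  have -> : h^-1 = seg (fun=> (h ^+ 2 + h ^+ 2)^-1) (y - h) (y + h).
    have h2 : h ^+ 2 + h ^+ 2 != 0 by rewrite gt_eqF// addr_gt0// exprn_gt0.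
    by rewrite seg_cst//; field; rewrite (gt_eqF h_gt0) h2.
  apply: le_seg; [exact: cst_cont_on|by move=> t _; exact: lorentz_cont|].
  move=> t /andP[t1 t2]; rewrite lef_pV2 ?posrE ?lorentz_den_gt0 ?addr_gt0 ?exprn_gt0//.
  rewrite lerD2l -[(t - y) ^+ 2]real_normK ?num_real//.
  apply: lerXn2r; rewrite ?nnegrE//; first exact: ltW.
  by rewrite ler_norml lerBrDl t1 lerBlDl.
have Fz0 := cmod_ge0 (F z).
have segI : ((h * seg (fun t => lorentz h y t * cmod (F (x0 +i* t)%C)) b d)%:E <=
    \int[mu]_t (h * (lorentz h y t * cmod (F (x0 +i* t)%C)))%:E)%E.
  have -> : h * seg (fun t => lorentz h y t * cmod (F (x0 +i* t)%C)) b d =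
      seg (fun t => h * (lorentz h y t * cmod (F (x0 +i* t)%C))) b d.
    have := @seg_lin R _ _ h 0 b d (ckF b d) (ckF b d); rewrite mul0r addr0 => <-.
    by congr seg; apply/funext => t; rewrite mul0r addr0.
  apply: seg_le_integral => //.
  - by move=> t _; apply: cvgM; [exact: cvg_cst|apply: (ckF t t); rewrite lexx].
  - by move=> t; rewrite !mulr_ge0 ?cmod_ge0 ?(ltW (lorentz_gt0 _ _ _))// ltW.
move: low lowl.
set S0 := seg _ b d; set S1 := seg _ b d; set S2 := seg _ b d.
set S3 := seg _ x0 X; set S4 := seg _ x0 X; set S5 := seg _ b d in segI *.
move=> low lowl /andP[_ a1] /andP[a2 _] /andP[_ a3] J0.
apply: (@le_trans _ _ (h * S1 + e')%:E); last by rewrite EFinD leeD2r.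
rewrite lee_fin.
have S2e : S2 <= 3 * e by clear - a1 a2 a3 J0; lra.
have ZS : cmod (F z) / h <= S1 + 3 * e.
  apply: (@le_trans _ _ (cmod (F z) * S0)); first by rewrite ler_wpM2l.
  by clear - low S2e; lra.
have -> : e' = h * (3 * e) by rewrite /e; field; rewrite gt_eqF.
by rewrite -mulrDr mulrC -ler_pdivrMr.
Qed.

End poisson_bound.


(** * The weak-type inequality *)

Section dyadic_layers.
Context {R : realType}.
Notation mu := (@lebesgue_measure R).

Lemma le_nneseries_term (u : nat -> \bar R) k : (forall n, 0 <= u n)%E ->
  (u k <= \sum_(0 <= n <oo) u n)%E.
Proof.
move=> u0; apply: (@le_trans _ _ (\sum_(0 <= n < k.+1) u n)%E); last first.
  by apply: nneseries_lim_ge => n _.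
by rewrite big_nat_recr//= leeDr// sume_ge0.
Qed.

(** The first dyadic interval around [y] that contains [t] gives the layer: outside
    the preceding one, [(t - y)^2] is at least [4^(k-1) h^2]. *)
Lemma lorentz_layer (h y t : R) : 0 < h -> exists k : nat,
  `|t - y| < 2 ^+ k * h /\ h * lorentz h y t <= 4 / (4 ^+ k * h).
Proof.
move=> h0.
have ex : exists k : nat, `|t - y| < 2 ^+ k * h.
  have [k hk] := exists_div_exp2_lt `|t - y| h0; exists k.
  by rewrite -ltr_pdivrMl ?exprn_gt0// mulrC.
have [[|k] hk kmin] := ex_minnP ex.
  exists 0%N; split => //; rewrite expr0 mul1r ler_pdivlMr// /lorentz.
  rewrite mulrAC -expr2 ler_pdivrMr ?lorentz_den_gt0//.
  rewrite (@le_trans _ _ (h ^+ 2 + (t - y) ^+ 2)) ?lerDl ?sqr_ge0//.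
  by have := lorentz_den_gt0 y t h0; lra.
exists k.+1; split => //.
have hk' : 2 ^+ k * h <= `|t - y|.
  by rewrite leNgt; apply/negP => /kmin; rewrite ltnn.
have p0 : 0 < 4 ^+ k.+1 * h :> R by rewrite mulr_gt0// exprn_gt0.
rewrite ler_pdivlMr// /lorentz mulrAC ler_pdivrMr ?lorentz_den_gt0//.
have : (2 ^+ k * h) ^+ 2 <= (t - y) ^+ 2.
  rewrite -[leRHS]real_normK ?num_real//.
  by apply: lerXn2r; rewrite ?nnegrE// mulr_ge0// ?exprn_ge0// ltW.
have e4 : 4 ^+ k = (2 ^+ k) ^+ 2 :> R by rewrite -exprM mulnC exprM; congr (_ ^+ k); rewrite -natrX.
rewrite exprMn -e4 => H; rewrite exprS.
have -> : h * (4 * 4 ^+ k * h) = 4 * (4 ^+ k * h ^+ 2) :> R by ring.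
by rewrite ler_pM2l// (le_trans H)// lerDr sqr_ge0.
Qed.

(** A Poisson integral is a superposition of means over intervals that are at
    least as long as the height [h]: the layer [k] has weight proportional to
    [2^(-k)] once its indicator is normalized. *)
Lemma poisson_le_averages (f : R -> R) (h y l : R) : 0 < h -> 0 <= l ->
  measurable_fun setT f -> (forall t, 0 <= f t) ->
  (forall r, h <= r -> (\int[mu]_(t in ball y r) (f t)%:E <= (l / 8 * r)%:E)%E) ->
  (\int[mu]_t (h * (lorentz h y t * f t))%:E <= l%:E)%E.
Proof.
move=> h0 l0 mf f0 hav.
pose c k : R := 4 / (4 ^+ k * h).
have c0 k : 0 <= c k by rewrite divr_ge0// mulr_ge0 ?exprn_ge0// ltW.
pose u k : R -> \bar R := (fun t => (c k * f t)%:E) \_ (ball y (2 ^+ k * h)).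
have u0 k t : (0 <= u k t)%E.
  by apply: erestrict_ge0 => s _; rewrite lee_fin mulr_ge0.
have mu_ k : measurable_fun setT (u k).
  apply/(measurable_restrictT _ (measurable_ball _ _)).
  by apply/measurable_EFinP; apply: measurable_funTS; exact: measurable_funM.
apply: (@le_trans _ _ (\int[mu]_t \sum_(0 <= k <oo) u k t)%E).
  apply: ge0_le_integral => //.
  - by move=> t _; rewrite lee_fin mulr_ge0 ?(ltW h0)// mulr_ge0// ltW// lorentz_gt0.
  - apply/measurable_EFinP; apply: measurable_funM => //.
    by apply: measurable_funM => //; exact: lorentz_meas.
  - apply: ge0_emeasurable_sum => [k t _ _|k _]; [exact: u0|exact: mu_].
  - move=> t _; have [k [tk lk]] := lorentz_layer y t h0.
    apply: (le_trans _ (le_nneseries_term k (fun n => u0 n t))).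
    rewrite /u patchE mem_set; last by rewrite /ball/= distrC.
    by rewrite lee_fin mulrA ler_wpM2r.
rewrite integral_nneseries//.
have ck k : (\int[mu]_t u k t <= (l / (2 ^ (k + 1))%:R)%:E)%E.
  rewrite /u -integral_mkcond.
  under eq_integral do rewrite EFinM.
  rewrite ge0_integralZl_EFin//; last 3 first.
  - exact: measurable_ball.
  - by move=> t _; rewrite lee_fin.
  - by apply/measurable_EFinP; exact: measurable_funTS.
  apply: (@le_trans _ _ ((c k)%:E * (l / 8 * (2 ^+ k * h))%:E)%E).
    by apply: lee_wpmul2l; rewrite ?lee_fin// hav// ler_peMl ?(ltW h0)// exprn_ege1// ler1n.
  rewrite -EFinM lee_fin le_eqVlt; apply/orP; left; apply/eqP.
  have e4 : 4 ^+ k = (2 ^+ k) * (2 ^+ k) :> R.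
    by rewrite -exprMn; congr (_ ^+ k); rewrite -natrM.
  rewrite /c e4 addn1 expnS natrM natrX; field.
  by rewrite (gt_eqF h0) expf_neq0.
apply: (@le_trans _ _ (\sum_(0 <= k <oo) (l / (2 ^ (k + 1))%:R)%:E)%E).
  by apply: lee_nneseries => // k _ _; apply: integral_ge0.
rewrite (cvg_lim _ (@cvg_geometric_eseries_half R l 0))//.
by rewrite expr0 divr1.
Qed.

End dyadic_layers.

Section plane_borel.
Context {R : realType}.
Implicit Type A : set R[i].

Lemma open_cmod A : (forall z, A z -> exists2 r : R, 0 < r &
  forall w, cmod (w - z) < r -> A w) -> @open R[i]^o A.
Proof.
move=> hA; rewrite openE => z /hA[r r0 hr].
apply/nbhs_ballP; exists (r%:C)%C => /=; first by rewrite ltcE/= eqxx.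
move=> w; rewrite /ball/= normcE_cmod ltcE/= eqxx/= => zw.
by apply: hr; rewrite cmodB.
Qed.

Lemma measurable_open_cmod A : (forall z, A z -> exists2 r : R, 0 < r &
  forall w, cmod (w - z) < r -> A w) -> measurable (A : set (borelC R)).
Proof. by move=> /open_cmod oA; apply: sub_sigma_algebra. Qed.

Lemma measurable_Re_gt (x : R) : measurable ([set z | x < complex.Re z] : set (borelC R)).
Proof.
apply: measurable_open_cmod => z /= xz.
exists (complex.Re z - x); first by rewrite subr_gt0.
move=> w wz; have := le_lt_trans (norm_Re_le _) wz; rewrite cReB ltr_norml => /andP[].
by clear; lra.
Qed.

Lemma measurable_carleson_box (a : R[i]) :
  measurable (carleson_box a : set (borelC R)).
Proof.
have -> : carleson_box a = [set z | 0 < complex.Re z] `&`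
   (~` [set z | 2 * complex.Re a < complex.Re z] `&`
    ~` [set z | complex.Re a < `|complex.Im z - complex.Im a|]).
  apply/seteqP; split => z /=.
    by move=> [/andP[z0 z1] z2]; split => //; split; apply/negP; rewrite -leNgt.
  move=> [z0 [/negP + /negP]]; rewrite -!leNgt => h1 h2.
  by split => //; apply/andP; split.
apply: measurableI; first exact: measurable_Re_gt.
apply: measurableI; apply: measurableC; first exact: measurable_Re_gt.
apply: measurable_open_cmod => z /= xz.
exists (`|complex.Im z - complex.Im a| - complex.Re a); first by rewrite subr_gt0.
move=> w wz; have := le_lt_trans (norm_Im_le _) wz; rewrite cImB => h.
have := ler_distD (complex.Im w) (complex.Im z) (complex.Im a).
by move: h; rewrite (distrC (complex.Im z) (complex.Im w)); clear; lra.
Qed.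

End plane_borel.

Section weak_type.
Context {R : realType}.
Notation leb := (@lebesgue_measure R).
Variable mu : {measure set (borelC R) -> \bar R}.
Variable C : R.
Hypothesis C_gt0 : 0 < C.
Hypothesis mu_box : forall a : R[i], Cplus a ->
  (mu (carleson_box a) <= (C * complex.Re a)%:E)%E.
Variable f : R -> R.
Hypotheses (mf : measurable_fun setT f) (f_ge0 : forall t, 0 <= f t).
Variable M2 : R.
Hypothesis f2 : (\int[leb]_t (f t ^+ 2)%:E <= M2%:E)%E.

Let trunc (l t : R) : R := if l < f t then f t else 0.

Lemma trunc_meas l : measurable_fun setT (trunc l).
Proof.
apply: measurable_fun_ifT => //.
by apply: measurable_fun_ltr => //; exact: measurable_cst.
Qed.

Lemma trunc_ge0 l t : 0 <= trunc l t.
Proof. by rewrite /trunc; case: ifP. Qed.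

(** The truncated function is integrable because it is at most [f^2 / l].  This
    bounds the radii in the covering argument. *)
Lemma integral_trunc_fin l : 0 < l -> (\int[leb]_t (trunc l t)%:E <= (l^-1 * M2)%:E)%E.
Proof.
move=> l0; rewrite EFinM.
apply: le_trans (lee_wpmul2l _ f2); last by rewrite lee_fin invr_ge0 ltW.
rewrite -ge0_integralZl_EFin//; last 3 first.
- by move=> t _; rewrite lee_fin sqr_ge0.
- by apply/measurable_EFinP; apply: measurable_funX.
- by rewrite invr_ge0 ltW.
apply: ge0_le_integral => //.
- by move=> t _; rewrite lee_fin trunc_ge0.
- by apply/measurable_EFinP; exact: trunc_meas.
- by apply/measurable_EFinP; apply: measurable_funM => //; apply: measurable_funX.
- move=> t _; rewrite -EFinM lee_fin /trunc; case: ifPn => h; last first.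
    by rewrite mulr_ge0 ?sqr_ge0// invr_ge0 ltW.
  by rewrite mulrC ler_pdivlMr// expr2 ler_wpM2l// ltW.
Qed.

(** Small values of [f] contribute at most half of the mean, so they can be cut
    off. *)
Lemma ball_average_trunc (l y r : R) : 0 < l -> 0 < r ->
  ((l / 8 * r)%:E < \int[leb]_(t in ball y r) (f t)%:E)%E ->
  ((l / 16 * r)%:E < \int[leb]_(t in ball y r) (trunc (l / 32) t)%:E)%E.
Proof.
move=> l0 r0 H.
have mB : measurable (ball y r) by exact: measurable_ball.
have fle : (\int[leb]_(t in ball y r) (f t)%:E <=
   \int[leb]_(t in ball y r) ((trunc (l / 32) t)%:E + (l / 32)%:E))%E.
  apply: ge0_le_integral => //.
  - by move=> t _; rewrite lee_fin.
  - by apply/measurable_EFinP; exact: measurable_funTS.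
  - apply/measurable_EFinP; apply: measurable_funD => //.
    by apply: measurable_funTS; exact: trunc_meas.
  - move=> t _; rewrite -EFinD lee_fin /trunc; case: ifPn => [_|].
      by rewrite lerDl divr_ge0// ltW.
    by rewrite -leNgt add0r.
move: fle.
have -> : (\int[leb]_(t in ball y r) ((trunc (l / 32) t)%:E + (l / 32)%:E) =
   \int[leb]_(t in ball y r) (trunc (l / 32) t)%:E + (l / 16 * r)%:E)%E.
  rewrite ge0_integralD//.
  - congr (_ + _)%E; rewrite integral_cst//.
    transitivity ((l / 32)%:E * (r *+ 2)%:E)%E.
      by congr (_ * _)%E; exact: lebesgue_measure_ball (ltW r0).
    by rewrite -EFinM; congr (_%:E); rewrite -mulr_natl; field.
  - by move=> t _; rewrite lee_fin trunc_ge0.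
  - by apply/measurable_EFinP; apply: measurable_funTS; exact: trunc_meas.
  - by move=> t _; rewrite lee_fin divr_ge0// ltW.
move=> /(lt_le_trans H).
have -> : l / 8 * r = l / 16 * r + l / 16 * r by field.
by rewrite EFinD lteD2rE.
Qed.

(** Each point of [E] lies, up to dilation, in the box over an interval where the
    mean of [f] is large.  Among these intervals Vitali's lemma selects disjoint
    ones whose dilates still cover; the measures of the boxes over the dilates are
    controlled by [mu_box], hence by the integrals of the truncation of [f] over
    disjoint intervals. *)
Lemma weak_type (E : set R[i]) (l : R) : 0 < l -> measurable (E : set (borelC R)) ->
  (forall z, E z -> exists r : R, [/\ 0 < r, 0 < complex.Re z, complex.Re z <= 2 * r &
     ((l / 8 * r)%:E < \int[leb]_(t in ball (complex.Im z) r) (f t)%:E)%E]) ->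
  (mu E <= (80 * C / l)%:E * \int[leb]_t (trunc (l / 32) t)%:E)%E.
Proof.
move=> l0 mE hE.
pose g := trunc (l / 32).
have mg : measurable_fun setT (fun t => (g t)%:E).
  by apply/measurable_EFinP; exact: trunc_meas.
have l32 : 0 < l / 32 by rewrite divr_gt0.
have K0 := integral_trunc_fin l32.
have ex z : exists r : R, 0 < r /\ (E z -> [/\ 0 < complex.Re z, complex.Re z <= 2 * r &
     ((l / 16 * r)%:E < \int[leb]_(t in ball (complex.Im z) r) (g t)%:E)%E]).
  have [Ez|nE] := pselect (E z); last by exists 1; split.
  have [r [r0 z0 zr hr]] := hE z Ez; exists r; split => // _; split => //.
  exact: ball_average_trunc.
pose r_ z := projT1 (cid (ex z)).
have r0 z : 0 < r_ z by case: (projT2 (cid (ex z))).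
have rE z : E z -> [/\ 0 < complex.Re z, complex.Re z <= 2 * r_ z &
     ((l / 16 * r_ z)%:E < \int[leb]_(t in ball (complex.Im z) (r_ z)) (g t)%:E)%E].
  by case: (projT2 (cid (ex z))).
pose B z := ball (complex.Im z) (r_ z) : set R.
have rB z : (radius (B z))%:num = r_ z by rewrite radius_ball_num// ltW.
have rbd z : E z -> (radius (B z))%:num <= (l / 16)^-1 * ((l / 32)^-1 * M2).
  move=> /rE[_ _ h]; rewrite rB mulrC ler_pdivlMr ?divr_gt0// mulrC -lee_fin.
  apply: le_trans K0; apply: (le_trans (ltW h)).
  apply: ge0_subset_integral => //; first exact: measurable_ball.
  by move=> t _; rewrite lee_fin trunc_ge0.
have isB z : is_ball (B z) by exact: is_ball_ball.
have Bpos z : 0 < (radius (B z))%:num by rewrite rB.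
have cB z : cpoint (B z) = complex.Im z by exact: cpoint_ball.
have inB z t : closure (B z) t -> `|complex.Im z - t| <= r_ z.
  by move=> /(is_ball_closureP (isB z)); rewrite (cB z) (rB z).
have [D [cD DE tD hD]] := vitali_lemma_infinite isB Bpos rbd.
have [code codeI] : exists code : R[i] -> nat, {in D &, injective code}.
  by have /countable_injP[code hc] := cD; exists code.
(* The countable family [D] is turned into a sequence, padded with empty sets. *)
pose has n := exists j, D j /\ code j = n.
pose jn n : R[i] := if pselect (has n) is left h then projT1 (cid h) else 0.
have jnP n : has n -> D (jn n) /\ code (jn n) = n.
  by rewrite /jn; case: pselect => // h _; exact: (projT2 (cid h)).
have jnD j : D j -> jn (code j) = j.
  move=> Dj; have [Dj' cj] := jnP (code j) (ex_intro _ j (conj Dj erefl)).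
  by apply: codeI; rewrite ?inE.
pose Q n : set (borelC R) :=
  if pselect (has n) then carleson_box ((5 * r_ (jn n)) +i* complex.Im (jn n))%C
  else set0.
pose Bn n := if pselect (has n) then B (jn n) else set0.
have mQ n : measurable (Q n).
  by rewrite /Q; case: pselect => //= ?; exact: measurable_carleson_box.
have mBn n : measurable (Bn n).
  by rewrite /Bn; case: pselect => //= ?; exact: measurable_ball.
have tBn : trivIset setT Bn.
  apply/trivIsetP => m n _ _ mn; rewrite /Bn.
  case: pselect => [hm|?] /=; last by rewrite set0I.
  case: pselect => [hn|?] /=; last by rewrite setI0.
  have [Dm cm] := jnP _ hm; have [Dn cn] := jnP _ hn.
  have jmn : jn m != jn n by apply: contra mn => /eqP e; rewrite -cm -cn e.
  move/trivIsetP : tD => /(_ _ _ Dm Dn jmn) /= h.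
  by apply: subsetI_eq0 h; exact: subset_closure.
have cover : E `<=` \bigcup_n Q n.
  move=> z Ez; have [j [Dj [t [/= tz tj]] rj _]] := hD z Ez.
  have hj : has (code j) by exists j.
  exists (code j) => //; rewrite /Q; case: pselect => //= ?; rewrite jnD//.
  have {}rj : r_ z / 2 <= r_ j by rewrite -(rB z) -(rB j).
  have [z0 zr _] := rE _ Ez.
  have h1 := inB j t tj; have h2 := inB z t tz.
  split => /=; first by rewrite z0/=; have rj0 := r0 j; clear - zr rj rj0; lra.
  rewrite (le_trans (ler_distD t _ _))//.
  rewrite (le_trans (lerD h2 (_ : _ <= r_ j)))//; first by rewrite distrC.
  by have rj0 := r0 j; clear - rj rj0; lra.
have sub := @measure_sigma_subadditive _ _ _ mu E Q mQ mE cover.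
apply: (le_trans sub).
apply: (@le_trans _ _ (\sum_(0 <= n <oo) (80 * C / l)%:E * \int[leb]_(t in Bn n) (g t)%:E)%E).
  apply: lee_nneseries => [n _ _|n _]; first exact: measure_ge0.
  rewrite /Q /Bn; case: pselect => [hn|?] /=; last first.
    by rewrite measure0 integral_set0 mule0.
  have [Dn cn] := jnP _ hn; have [_ _ hr] := rE _ (DE _ Dn).
  apply: (le_trans (mu_box _)); first by rewrite /Cplus/= mulr_gt0.
  have -> /= : C * (5 * r_ (jn n)) = 80 * C / l * (l / 16 * r_ (jn n)).
    by field; rewrite gt_eqF.
  rewrite EFinM; apply: lee_wpmul2l; last exact: ltW.
  by rewrite lee_fin divr_ge0 ?mulr_ge0// ltW.
rewrite nneseriesZl; last first.
  by move=> n _; apply: integral_ge0 => t _; rewrite lee_fin trunc_ge0.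
apply: lee_wpmul2l; first by rewrite lee_fin divr_ge0 ?mulr_ge0// ltW.
rewrite -ge0_integral_bigcup//; last 2 first.
- exact: measurable_funTS.
- by move=> t _; rewrite lee_fin trunc_ge0.
apply: ge0_subset_integral => //.
- by apply: bigcup_measurable => n _; exact: mBn.
- by move=> t _; rewrite lee_fin trunc_ge0.
Qed.

End weak_type.


(** * The embedding of the Hardy space *)

Section strong_type.
Context {R : realType}.
Notation leb := (@lebesgue_measure R).

Lemma nneseries_le_bound (u : nat -> \bar R) (B : \bar R) : (forall n, 0 <= u n)%E ->
  (forall n, \sum_(0 <= k < n) u k <= B)%E -> (\sum_(0 <= k <oo) u k <= B)%E.
Proof.
move=> u0 uB; apply: lime_le; first by apply: is_cvg_nneseries => n _ _.
by apply: nearW => n; exact: uB.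
Qed.

(** A geometric sum is at most twice its last term. *)
Lemma sum_dyadic_below (d s : R) n : 0 < d -> 0 <= s ->
  \sum_(0 <= j < n) (if d * 2 ^+ j < s then d * 2 ^+ j else 0) <= 2 * s.
Proof.
move=> d0 s0.
have p k : 0 < d * 2 ^+ k by rewrite mulr_gt0// exprn_gt0.
have aux k : \sum_(0 <= j < k) (if d * 2 ^+ j < s then d * 2 ^+ j else 0) <= d * 2 ^+ k.
  elim: k => [|k IH]; first by rewrite big_nil ltW.
  rewrite big_nat_recr//= exprS (_ : d * (2 * 2 ^+ k) = d * 2 ^+ k + d * 2 ^+ k); last by ring.
  by rewrite lerD//; case: ifP => // _; exact: ltW.
elim: n => [|n IH]; first by rewrite big_nil mulr_ge0.
rewrite big_nat_recr//=; case: ifPn => h; last by rewrite addr0.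
have := aux n; move: h; set S := \sum_(_ <= _ < _) _; clear; lra.
Qed.

Lemma dyadic_bracket (d s : R) : 0 < d -> d < s -> exists j : nat,
  d * 2 ^+ j < s /\ s <= d * 2 ^+ j.+1.
Proof.
move=> d0 ds.
have s0 : 0 < s by exact: lt_trans ds.
have ex : exists j : nat, s <= d * 2 ^+ j.
  have [k hk] := exists_div_exp2_lt s d0; exists k.
  by rewrite -ler_pdivrMr ?exprn_gt0// ltW.
have [[|j] hj jmin] := ex_minnP ex.
  by move: hj; rewrite expr0 mulr1 leNgt ds.
exists j; split => //; rewrite ltNge; apply/negP => /jmin.
by rewrite ltnn.
Qed.

Variable mu : {measure set (borelC R) -> \bar R}.
Variable C : R.
Hypothesis C_gt0 : 0 < C.
Hypothesis mu_box : forall a : R[i], Cplus a ->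
  (mu (carleson_box a) <= (C * complex.Re a)%:E)%E.
Variable F : R[i]^o -> R[i]^o.
Hypothesis hF : analytic_Cplus F.
Variable M2 : R.
Hypothesis hM : forall x : R, 0 < x ->
  (\int[leb]_s (cmod (F (x +i* s)%C) ^+ 2)%:E <= M2%:E)%E.

(** The level sets are cut at [2 * x0] so that the height above the line of
    abscissa [x0] is comparable to the distance to the boundary. *)
Definition level_set (x0 l : R) : set (borelC R) :=
  [set z | 2 * x0 < complex.Re z /\ l < cmod (F z)].

Lemma level_set_measurable x0 l : 0 < x0 -> measurable (level_set x0 l).
Proof.
move=> x0_gt0; apply: measurable_open_cmod => z [/= xz lz].
have z0 : 0 < complex.Re z by apply: lt_trans xz; rewrite mulr_gt0.
have e0 : 0 < cmod (F z) - l by rewrite subr_gt0.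
have [d d0 Hd] := cdiff_cont (analytic_cdiff hF z0) e0.
exists (Num.min d (complex.Re z - 2 * x0)); first by rewrite lt_min d0 subr_gt0.
move=> w; rewrite lt_min => /andP[wd wx]; split => /=.
  have := le_lt_trans (norm_Re_le _) wx; rewrite cReB ltr_norml => /andP[].
  by lra.
have := Hd _ wd; have := cmodD (F z - F w) (F w); rewrite subrK cmodB.
by lra.
Qed.

Lemma level_set_le x0 l : 0 < x0 -> 0 < l ->
  (mu (level_set x0 l) <= (80 * C / l)%:E *
    \int[leb]_t (if l / 32 < cmod (F (x0 +i* t)%C) then cmod (F (x0 +i* t)%C) else 0)%:E)%E.
Proof.
move=> x0_gt0 l0.
have mf : measurable_fun setT (fun t => cmod (F (x0 +i* t)%C)).
  by apply: continuous_measurable_fun => t; exact: cmod_cont_y.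
apply: (@weak_type R mu C C_gt0 mu_box _ mf (fun=> cmod_ge0 _) M2 (hM x0_gt0)) => //.
  exact: level_set_measurable.
move=> z [/= xz lz]; set h := complex.Re z - x0.
have h0 : 0 < h by rewrite subr_gt0; apply: le_lt_trans xz; lra.
have hh : complex.Re z <= 2 * h by rewrite /h; lra.
have zE : z = ((x0 + h) +i* complex.Im z)%C.
  by apply/eqP; rewrite eq_complex /= eqxx andbT /h addrC subrK.
have pb := poisson_bound (complex.Im z) hF x0_gt0 h0 hM.
rewrite -zE in pb.
apply: contrapT => no.
suff : ((cmod (F z))%:E <= l%:E)%E by rewrite lee_fin leNgt lz.
apply: (le_trans pb); apply: poisson_le_averages => //; first exact: ltW.
  by move=> t; exact: cmod_ge0.
move=> r hr; rewrite leNgt; apply/negP => H; apply: no; exists r; split => //.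
- exact: lt_le_trans hr.
- by apply: lt_trans xz; rewrite mulr_gt0.
- by rewrite (le_trans hh)// ler_wpM2l.
Qed.

Lemma sqr_cmod_meas_plane (D : set (borelC R)) : measurable D -> D `<=` @Cplus R ->
  measurable_fun D (fun z : borelC R => (cmod (F z) ^+ 2)%:E).
Proof.
move=> mD DC; apply: (@measurable_funS _ _ (borelC R) _ (@Cplus R : set (borelC R))) => //.
  exact: measurable_Re_gt.
apply/measurable_EFinP; apply: measurable_fun_of_rays => a.
apply: measurable_open_cmod => z [/= z0 az].
have e0 : 0 < cmod (F z) ^+ 2 - a by rewrite subr_gt0.
have [d d0 Hd] := sqr_cmod_close hF z0 e0.
exists (Num.min d (complex.Re z)); first by rewrite lt_min d0.
move=> w; rewrite lt_min => /andP[wd wx]; split.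
  have := le_lt_trans (norm_Re_le _) wx; rewrite cReB ltr_norml => /andP[].
  by rewrite /Cplus/=; lra.
by have := Hd _ wd; rewrite ltr_norml => /andP[] /=; lra.
Qed.

Lemma level_set_Cplus x0 l : 0 < x0 -> level_set x0 l `<=` @Cplus R.
Proof. by move=> x0_gt0 z [/= xz _]; apply: lt_trans xz; rewrite mulr_gt0. Qed.

(** Summation of the weak-type estimate over dyadic levels: in the resulting
    integral, the levels [l < 32 f t] form a geometric sum comparable to [f t],
    which restores [f^2].  The bound depends neither on [x0] nor on [d]. *)
Lemma embedding_on_level_set x0 d : 0 < x0 -> 0 < d ->
  (\int[mu]_(z in level_set x0 d) (cmod (F z) ^+ 2)%:E <= (4 * 80 * (2 * 32) * C * M2)%:E)%E.
Proof.
move=> x0_gt0 d0.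
pose l j := d * 2 ^+ j.
have l0 j : 0 < l j by rewrite mulr_gt0// exprn_gt0.
pose c j := 4 * l j ^+ 2.
have c0 j : 0 <= c j by rewrite mulr_ge0// sqr_ge0.
pose u j : borelC R -> \bar R := (fun=> (c j)%:E) \_ (level_set x0 (l j)).
have mL j : measurable (level_set x0 (l j)) by exact: level_set_measurable.
have mu_ j : measurable_fun setT (u j) by apply/(measurable_restrictT _ (mL j)).
have u0 j z : (0 <= u j z)%E by apply: erestrict_ge0 => w _; rewrite lee_fin.
have mE : measurable (level_set x0 d) by exact: level_set_measurable.
apply: (@le_trans _ _ (\int[mu]_(z in level_set x0 d) \sum_(0 <= j <oo) u j z)%E).
  apply: ge0_le_integral => //.
  - by move=> z _; rewrite lee_fin sqr_ge0.
  - by apply: sqr_cmod_meas_plane => //; exact: level_set_Cplus.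
  - apply: measurable_funTS; apply: ge0_emeasurable_sum => [j z _ _|j _]; [exact: u0|exact: mu_].
  - move=> z [/= xz dz]; have [j [j1 j2]] := dyadic_bracket d0 dz.
    apply: (le_trans _ (le_nneseries_term j (fun n => u0 n z))).
    rewrite /u patchE mem_set// lee_fin /c /l.
    have -> : 4 * (d * 2 ^+ j) ^+ 2 = (d * 2 ^+ j.+1) ^+ 2 by rewrite [2 ^+ j.+1]exprS; ring.
    by apply: lerXn2r; rewrite ?nnegrE ?cmod_ge0// ltW// mulr_gt0// exprn_gt0.
rewrite integral_nneseries//; last by move=> j; exact: measurable_funTS.
pose v j (t : R) := 4 * 80 * C * (l j * (if l j / 32 < cmod (F (x0 +i* t)%C)
  then cmod (F (x0 +i* t)%C) else 0)).
have v0 j t : (0 <= (v j t)%:E)%E.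
  rewrite lee_fin; apply: mulr_ge0; first by rewrite mulr_ge0// ltW.
  apply: mulr_ge0; first by rewrite ltW.
  by case: (_ < _) => //; exact: cmod_ge0.
have mf : measurable_fun setT (fun t => cmod (F (x0 +i* t)%C)).
  by apply: continuous_measurable_fun => t; exact: cmod_cont_y.
have mt j : measurable_fun setT (fun t => if l j / 32 < cmod (F (x0 +i* t)%C)
  then cmod (F (x0 +i* t)%C) else 0) by exact: trunc_meas.
have mv j : measurable_fun setT (fun t => (v j t)%:E).
  by apply/measurable_EFinP; do 2 apply: measurable_funM => //.
have uv j : (\int[mu]_(z in level_set x0 d) u j z <= \int[leb]_t (v j t)%:E)%E.
  apply: (@le_trans _ _ (\int[mu]_z u j z)%E).
    by apply: ge0_subset_integral => //.
  rewrite /u -integral_mkcond integral_cst//.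
  apply: (@le_trans _ _ ((c j)%:E * ((80 * C / l j)%:E *
    \int[leb]_t (if l j / 32 < cmod (F (x0 +i* t)%C)
       then cmod (F (x0 +i* t)%C) else 0)%:E))%E).
    by apply: lee_wpmul2l; rewrite ?lee_fin//; exact: level_set_le.
  rewrite muleA -EFinM -ge0_integralZl_EFin//; last 3 first.
  - by move=> t _; rewrite lee_fin; case: ifP => // _; exact: cmod_ge0.
  - by apply/measurable_EFinP; exact: mt.
  - by rewrite mulr_ge0// divr_ge0 ?mulr_ge0// ltW.
  rewrite le_eqVlt; apply/orP; left; apply/eqP; apply: eq_integral => t _.
  rewrite -EFinM /v /c; congr (_%:E); rewrite [RHS]mulrA; congr (_ * _).
  by field; rewrite gt_eqF.
apply: (@le_trans _ _ (\sum_(0 <= j <oo) \int[leb]_t (v j t)%:E)%E).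
  by apply: lee_nneseries => [j _ _|j _]; [exact: integral_ge0|exact: uv].
rewrite -integral_nneseries//.
apply: (@le_trans _ _ (\int[leb]_t ((4 * 80 * (2 * 32) * C)%:E * (cmod (F (x0 +i* t)%C) ^+ 2)%:E))%E).
  apply: ge0_le_integral => //.
  - by move=> t _; apply: nneseries_ge0 => j _ _.
  - by apply: ge0_emeasurable_sum => [j z _ _|j _]; [exact: v0|exact: mv].
  - apply/measurable_EFinP; apply: measurable_funM => //.
    exact: (sqr_cmod_meas_y hF).
  - move=> t _; apply: nneseries_le_bound => // n.
    rewrite sumEFin -EFinM lee_fin /v -big_distrr/=.
    set s := cmod _; have s0 : 0 <= s by exact: cmod_ge0.
    have := @sum_dyadic_below d (32 * s) n d0 (mulr_ge0 (ler0n _ 32) s0).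
    have -> : \sum_(0 <= j < n) l j * (if l j / 32 < s then s else 0) =
        (\sum_(0 <= j < n) (if d * 2 ^+ j < 32 * s then d * 2 ^+ j else 0)) * s.
      rewrite big_distrl/=; apply: eq_bigr => j _.
      by rewrite ltr_pdivrMr// [s * 32]mulrC -/(l j); case: ifP => _; rewrite ?mul0r ?mulr0.
    set S := \sum_(_ <= _ < _) _ => hS.
    have -> : 4 * 80 * (2 * 32) * C * s ^+ 2 = 4 * 80 * C * (2 * (32 * s) * s) by ring.
    by rewrite ler_wpM2l ?mulr_ge0 ?(ltW C_gt0)// ler_wpM2r.
rewrite ge0_integralZl_EFin//; last 3 first.
- by move=> t _; rewrite lee_fin sqr_ge0.
- by apply/measurable_EFinP; exact: (sqr_cmod_meas_y hF).
- by rewrite mulr_ge0// ltW.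
by rewrite [leRHS]EFinM; apply: lee_wpmul2l; [rewrite lee_fin mulr_ge0// ltW|exact: hM].
Qed.

(** The Carleson embedding theorem: a bound on the mean squares of [F] over all
    vertical lines controls its integral against [mu]. *)
Lemma hardy_embedding :
  (\int[mu]_(z in @Cplus R) (cmod (F z) ^+ 2)%:E <= (4 * 80 * (2 * 32) * C * M2)%:E)%E.
Proof.
(* The level sets exhaust the points of the half-plane where [F] is not zero. *)
pose A n := level_set n.+1%:R^-1 n.+1%:R^-1.
have n0 n : 0 < n.+1%:R^-1 :> R by rewrite invr_gt0.
have ndA : nondecreasing_seq A.
  apply/nondecreasing_seqP => n; rewrite subsetEset => z [/= h1 h2].
  have le : n.+2%:R^-1 <= n.+1%:R^-1 :> R by rewrite lef_pV2 ?posrE// ler_nat.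
  by split => /=; [apply: le_lt_trans h1; rewrite ler_wpM2l|exact: le_lt_trans h2].
have mA n : measurable (A n) by exact: level_set_measurable.
have mfA n : measurable_fun (A n) (fun z : borelC R => (cmod (F z) ^+ 2)%:E).
  by apply: sqr_cmod_meas_plane => //; exact: level_set_Cplus.
have A0 n z : A n z -> (0 <= (cmod (F z) ^+ 2)%:E)%E by rewrite lee_fin sqr_ge0.
have cv := ge0_nondecreasing_set_cvg_integral (mu := mu) ndA mA mfA A0.
have -> : (\int[mu]_(z in @Cplus R) (cmod (F z) ^+ 2)%:E =
    \int[mu]_(z in \bigcup_n A n) (cmod (F z) ^+ 2)%:E)%E.
  rewrite integral_mkcond [RHS]integral_mkcond; apply: eq_integral => z _.
  rewrite !patchE; case: ifPn => zC; last first.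
    case: ifPn => // /set_mem[n _] /(level_set_Cplus (n0 n)) h.
    by move/negP : zC; case; rewrite inE.
  case: ifPn => // /negP zA; have [Fz|Fz] := eqVneq (F z) 0.
    by rewrite Fz cmod0 expr0n.
  move/set_mem : zC => zC.
  case: zA; rewrite inE.
  have m0 : 0 < Num.min (complex.Re z / 2) (cmod (F z)).
    by rewrite lt_min divr_gt0// cmod_gt0.
  have [n hn] : exists n : nat, n.+1%:R^-1 < Num.min (complex.Re z / 2) (cmod (F z)).
    exists (Num.bound (Num.min (complex.Re z / 2) (cmod (F z)))^-1).
    rewrite invf_plt ?posrE//.
    by rewrite (lt_trans (archi_boundP _))// ?ltr_nat// invr_ge0 ltW.
  exists n => //; move: hn; rewrite lt_min => /andP[h1 h2]; split => //=.
  by rewrite mulrC -ltr_pdivlMr.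
rewrite -(cvg_lim _ cv)//; apply: lime_le; first by apply/cvg_ex; eexists; exact: cv.
by apply: nearW => n; exact: embedding_on_level_set.
Qed.

End strong_type.


(** * The two implications *)

Section sufficiency.
Context {R : realType}.
Notation leb := (@lebesgue_measure R).

Lemma carleson_of_box (mu : {measure set (borelC R) -> \bar R}) (C : R) : 0 < C ->
  (forall a : R[i], Cplus a -> (mu (carleson_box a) <= (C * complex.Re a)%:E)%E) ->
  carleson_measure mu.
Proof.
move=> C0 hmu; have pi2 : 0 < 2 * pi :> R by rewrite mulr_gt0// pi_gt0.
have K0 : 0 < 4 * 80 * (2 * 32) * C * (2 * pi) by rewrite !mulr_gt0// pi_gt0.
exists (4 * 80 * (2 * 32) * C * (2 * pi)) => // F [hF hfin].
pose S := ereal_sup [set (\int[leb]_y (sqmod (F (x +i* y)%C) / (2 * pi))%:E)%E |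
  x in [set x : R | 0 < x]].
have SN : (S <= dirichlet_sqnorm F)%E.
  rewrite /dirichlet_sqnorm leeDl// integral_ge0// => p _.
  by rewrite lee_fin divr_ge0 ?sqr_ge0// pi_ge0.
have lineS (x : R) : 0 < x ->
    (\int[leb]_y (sqmod (F (x +i* y)%C) / (2 * pi))%:E <= S)%E.
  by move=> x0; apply: ereal_sup_ubound; exists x.
have S0 : (0 <= S)%E.
  apply: le_trans (lineS 1 ltr01); apply: integral_ge0 => y _.
  by rewrite lee_fin divr_ge0 ?sqr_ge0// ltW.
have Sfin : S \is a fin_num by rewrite ge0_fin_numE// (le_lt_trans SN).
have hM (x : R) : 0 < x ->
    (\int[leb]_s (cmod (F (x +i* s)%C) ^+ 2)%:E <= (2 * pi * fine S)%:E)%E.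
  move=> x0; rewrite EFinM fineK//.
  apply: le_trans (lee_wpmul2l _ (lineS x x0)); last by rewrite lee_fin ltW.
  rewrite -ge0_integralZl_EFin//; last 3 first.
  - by move=> y _; rewrite lee_fin divr_ge0 ?sqr_ge0// ltW.
  - apply/measurable_EFinP; apply: measurable_funM => //.
    exact: (sqr_cmod_meas_y hF).
  - exact: ltW.
  rewrite le_eqVlt; apply/orP; left; apply/eqP; apply: eq_integral => y _.
  by rewrite -EFinM mulrC divfK// gt_eqF.
apply: (le_trans (hardy_embedding C0 hmu hF hM)).
have -> : 4 * 80 * (2 * 32) * C * (2 * pi * fine S) = 4 * 80 * (2 * 32) * C * (2 * pi) * fine S by ring.
by rewrite EFinM fineK//; apply: lee_wpmul2l => //; rewrite lee_fin ltW.
Qed.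

End sufficiency.

Section test_function.
Context {R : realType}.
Notation leb := (@lebesgue_measure R).
Variable a : R[i].
Hypothesis a_gt0 : 0 < complex.Re a.

(** The reproducing kernel of the Hardy space at [a]; its modulus is comparable to
    its maximum on the whole box of [a]. *)
Definition test_fun (z : R[i]^o) : R[i]^o := (z + a^*%C)^-1.

Lemma test_den_neq0 (z : R[i]) : 0 < complex.Re z -> z + a^*%C != 0.
Proof.
move=> z0; apply/eqP => /(congr1 (@complex.Re R)).
case: a a_gt0 => p q /= p0; rewrite cReD /= => h.
by have := addr_gt0 z0 p0; rewrite h ltxx.
Qed.

Lemma test_fun_derive (z : R[i]^o) : 0 < complex.Re z ->
  is_derive z 1 test_fun (- (test_fun z * test_fun z)).
Proof.
move=> z0.
pose V := R[i]^o.
pose den : V -> V := id + cst (a^*%C : V).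
have d1 : is_derive z (1 : V) den (1 + 0).
  exact: is_deriveD.
have nz : den z != 0 by exact: test_den_neq0.
have dd := @ex_derive _ _ _ _ _ _ _ d1.
apply: DeriveDef; first exact: (@derivableV _ _ den _ _ nz dd).
have -> : (test_fun : V -> V) = (fun y => (den y)^-1) by [].
rewrite (@deriveV _ _ den _ _ nz dd) (@derive_val _ _ _ _ _ _ _ d1) addr0.
by rewrite /GRing.scale/= mulr1 -expr2 exprVn.
Qed.

Lemma test_fun_analytic : analytic_Cplus test_fun.
Proof. by move=> z z0; exact: (@ex_derive _ _ _ _ _ _ _ (test_fun_derive z0)). Qed.

Lemma test_fun_sqmod (x y : R) : cmod (test_fun (x +i* y)%C) ^+ 2 =
  lorentz (x + complex.Re a) (complex.Im a) y.
Proof.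
rewrite /test_fun cmodV exprVn cmod_sqr /lorentz; congr (_^-1).
by rewrite cReD cImD; case: a => p q /=.
Qed.

(** Along a vertical line, [|F|^2] is a Lorentzian.  Since [|F'|^2] is its square,
    integration in the ordinate leaves [(x + Re a)^(-3)], which is compared to
    another Lorentzian to avoid a further primitive. *)
Lemma test_fun_norm : (dirichlet_sqnorm test_fun <=
  ((2 * complex.Re a)^-1 + pi / complex.Re a ^+ 2)%:E)%E.
Proof.
set al := complex.Re a; have al_gt0 : 0 < al by exact: a_gt0.
have pi0 : 0 < pi :> R by exact: pi_gt0.
rewrite EFinD /dirichlet_sqnorm; apply: leeD.
  apply: ge_ereal_sup => _ [x /= x0 <-].
  have s0 : 0 < x + al by rewrite addr_gt0.
  have -> : (fun y : R => (sqmod (test_fun (x +i* y)%C) / (2 * pi))%:E) =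
    (fun y => (2 * pi)^-1%:E * (lorentz (x + al) (complex.Im a) y)%:E)%E.
    by apply/funext => y; rewrite -EFinM mulrC -test_fun_sqmod.
  rewrite ge0_integralZl_EFin//; last 3 first.
  - by move=> y _; rewrite lee_fin ltW// lorentz_gt0.
  - by apply/measurable_EFinP; exact: lorentz_meas.
  - by rewrite invr_ge0 mulr_ge0// ltW.
  apply: (@le_trans _ _ ((2 * pi)^-1%:E * (pi / (x + al))%:E)%E).
    by apply: lee_wpmul2l; [rewrite lee_fin invr_ge0 mulr_ge0// ltW|exact: integral_lorentz].
  rewrite -EFinM lee_fin.
  have -> : (2 * pi)^-1 * (pi / (x + al)) = (2 * (x + al))^-1.
    move: pi0 s0; generalize (pi : R) (x + al) => p s p0 s0.
    by field; rewrite (gt_eqF p0) (gt_eqF s0).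
  by rewrite lef_pV2 ?posrE ?mulr_gt0// ler_pM2l// lerDr ltW.
pose D : set (R * R) := [set p | 0 < p.1].
pose k (p : R * R) := (sqmod (derive1 test_fun (p.1 +i* p.2)%C) / pi)%:E.
have kE p : D p -> k p = (lorentz (p.1 + al) (complex.Im a) p.2 ^+ 2 / pi)%:E.
  move=> p0; rewrite /k derive1E (@derive_val _ _ _ _ _ _ _ (test_fun_derive _))//.
  congr ((_ / _)%:E); rewrite /sqmod -/(cmod _) cmodN cmodM -expr2.
  by rewrite -test_fun_sqmod.
have DE : D = `]0, +oo[%classic `*` setT.
  by apply/seteqP; split => p; rewrite /D/= in_itv/= andbT; [split|case].
have mD : measurable D by rewrite DE; apply: measurableX => //; exact: measurable_itv.
pose f := k \_ D.
have f0 p : (0 <= f p)%E.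
  by apply: erestrict_ge0 => q _; rewrite lee_fin divr_ge0 ?sqr_ge0// ltW.
have sq_analytic : analytic_Cplus (fun z : R[i]^o => test_fun z * test_fun z : R[i]^o).
  by move=> z z0; have := test_fun_analytic z0 => h; exact: (derivableM h h).
have mf : measurable_fun setT f.
  apply/(measurable_restrictT k mD).
  apply: (eq_measurable_fun (fun p : R * R =>
    (cmod (test_fun (p.1 +i* p.2)%C * test_fun (p.1 +i* p.2)%C) ^+ 2 / pi)%:E)).
    by move=> p /set_mem Dp; rewrite kE// cmodM -expr2 -test_fun_sqmod.
  apply/measurable_EFinP; apply: measurable_funM => //.
  exact: (sqr_cmod_meas sq_analytic).
rewrite integral_mkcond fubini_tonelli1//.
apply: (@le_trans _ _ (\int[leb]_x ((al^-1)%:E * (lorentz al 0 x)%:E))%E); last first.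
  rewrite ge0_integralZl_EFin//; last 3 first.
  - by move=> x _; rewrite lee_fin ltW// lorentz_gt0.
  - by apply/measurable_EFinP; exact: lorentz_meas.
  - by rewrite invr_ge0 ltW.
  apply: (@le_trans _ _ ((al^-1)%:E * (pi / al)%:E)%E).
    by apply: lee_wpmul2l; [rewrite lee_fin invr_ge0 ltW|exact: integral_lorentz].
  by rewrite -EFinM lee_fin le_eqVlt; apply/orP; left; apply/eqP; rewrite expr2 invfM; ring.
apply: ge0_le_integral => //.
- by move=> x _; apply: integral_ge0.
- exact: (measurable_fun_fubini_tonelli_F (m2 := leb) f mf f0).
- apply/measurable_EFinP; apply: measurable_funM => //; exact: lorentz_meas.
move=> x _; rewrite /fubini_F.
have [x0|x0] := ltP 0 x; last first.
  rewrite integral0_eq.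
    rewrite -EFinM lee_fin; apply: mulr_ge0; first by rewrite invr_ge0 ltW.
    by rewrite ltW// lorentz_gt0.
  move=> y _; rewrite /f patchE; case: ifPn => // /set_mem.
  by rewrite /D/= ltNge x0.
have s0 : 0 < x + al by rewrite addr_gt0.
apply: (@le_trans _ _ (\int[leb]_y (((x + al) ^- 2 / pi)%:E *
    (lorentz (x + al) (complex.Im a) y)%:E))%E).
  apply: ge0_le_integral.
  - exact: measurableT.
  - by move=> y _; exact: f0.
  - by apply: (measurableT_comp mf); exact: pair1_measurable.
  - by apply/measurable_EFinP; apply: measurable_funM => //; exact: lorentz_meas.
  - move=> y _.
    have Dxy : D (x, y) by [].
    have fE : f (x, y) = (lorentz (x + al) (complex.Im a) y ^+ 2 / pi)%:E.
      by rewrite /f patchE mem_set// kE.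
    rewrite [leLHS](_ : _ = f (x, y))// fE -EFinM lee_fin.
    set l := lorentz _ _ _; have l0 : 0 < l by exact: lorentz_gt0.
    have -> : (x + al) ^- 2 / pi * l = l * (x + al) ^- 2 / pi by ring.
    rewrite expr2 ler_pM2r ?invr_gt0// ler_pM2l//.
    by rewrite lef_pV2 ?posrE ?lorentz_den_gt0 ?exprn_gt0// lerDl sqr_ge0.
rewrite ge0_integralZl_EFin//; last 3 first.
- by move=> y _; rewrite lee_fin ltW// lorentz_gt0.
- by apply/measurable_EFinP; exact: lorentz_meas.
- by rewrite divr_ge0 ?(ltW pi0)// invr_ge0 sqr_ge0.
apply: (@le_trans _ _ (((x + al) ^- 2 / pi)%:E * (pi / (x + al))%:E)%E).
  apply: lee_wpmul2l; last exact: integral_lorentz.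
  by rewrite lee_fin divr_ge0 ?(ltW pi0)// invr_ge0 sqr_ge0.
rewrite -!EFinM lee_fin /lorentz subr0.
have -> : (x + al) ^- 2 / pi * (pi / (x + al)) = ((x + al) ^+ 2 * (x + al))^-1.
  move: pi0 s0; generalize (pi : R) (x + al) => p s p0 s0.
  by field; rewrite (gt_eqF p0) (gt_eqF s0).
have p1 : 0 < al ^+ 2 + x ^+ 2 by rewrite ltr_pwDl ?exprn_gt0 ?sqr_ge0.
rewrite -invfM lef_pV2 ?posrE ?mulr_gt0 ?exprn_gt0//.
rewrite mulrC; apply: ler_pM; [exact: ltW|exact: ltW| |by rewrite lerDr ltW].
have -> : (x + al) ^+ 2 = al ^+ 2 + x ^+ 2 + 2 * (x * al) by ring.
by rewrite lerDl mulr_ge0// mulr_ge0// ltW.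
Qed.

Lemma test_fun_dirichlet : @dirichlet_space R test_fun.
Proof.
by split; [exact: test_fun_analytic|rewrite (le_lt_trans test_fun_norm)// ltry].
Qed.

Lemma test_fun_box (z : R[i]) : carleson_box a z ->
  (10 * complex.Re a ^+ 2)^-1 <= cmod (test_fun z) ^+ 2.
Proof.
move: a_gt0; set al := complex.Re a => al0.
case: z => x y [/= /andP[x0 x1] y1].
have p1 : 0 < (x + al) ^+ 2 + (y - complex.Im a) ^+ 2.
  by apply: lorentz_den_gt0; rewrite addr_gt0.
have p2 : 0 < 10 * al ^+ 2 by rewrite mulr_gt0// exprn_gt0.
rewrite test_fun_sqmod /lorentz -/al lef_pV2 ?posrE//.
have h1 : (x + al) ^+ 2 <= (3 * al) ^+ 2.
  have xa : 0 <= x + al by rewrite addr_ge0// ltW.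
  have la : x + al <= 3 * al.
    by move: x1; rewrite -/al; move: (al) => t; lra.
  by rewrite ler_pXn2r// nnegrE (le_trans xa).
have h2 : (y - complex.Im a) ^+ 2 <= al ^+ 2.
  by rewrite -[leLHS]real_normK ?num_real// ler_pXn2r// nnegrE ltW.
have -> : 10 * al ^+ 2 = (3 * al) ^+ 2 + al ^+ 2 by ring.
exact: lerD.
Qed.

End test_function.

Section necessity.
Context {R : realType}.

Lemma box_of_carleson (mu : {measure set (borelC R) -> \bar R}) :
  carleson_measure mu -> exists2 C : R, 0 < C & forall a : R[i], Cplus a ->
    (mu (carleson_box a) <= (C * (complex.Re a + 1))%:E)%E.
Proof.
move=> [C C0 hC].
have pi0 : 0 < pi :> R by exact: pi_gt0.
(* With [al = Re a]: [10 al^2 (1 / (2 al) + pi / al^2) = 5 al + 10 pi]. *)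
exists (C * (5 + 10 * pi)); first by rewrite mulr_gt0// addr_gt0// mulr_gt0.
move=> a a0; have al0 : 0 < complex.Re a by [].
set al := complex.Re a in al0 *.
have mQ := measurable_carleson_box a.
have mC : measurable (@Cplus R : set (borelC R)) by exact: measurable_Re_gt.
have QC : carleson_box a `<=` @Cplus R by move=> z [/andP[]].
have hF := test_fun_analytic a0.
have := hC _ (test_fun_dirichlet a0).
have c0 : 0 < 10 * al ^+ 2 by rewrite mulr_gt0// exprn_gt0.
have low : (((10 * al ^+ 2)^-1)%:E * mu (carleson_box a) <=
    \int[mu]_(z in @Cplus R) (sqmod (test_fun a z))%:E)%E.
  rewrite -integral_cst//.
  apply: (@le_trans _ _ (\int[mu]_(z in carleson_box a) (sqmod (test_fun a z))%:E)%E).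
    apply: ge0_le_integral => //.
    - by move=> z _; rewrite lee_fin invr_ge0 ltW.
    - exact: (sqr_cmod_meas_plane hF mQ QC).
    - by move=> z Qz; rewrite lee_fin; exact: test_fun_box.
  apply: ge0_subset_integral => //.
  - exact: (sqr_cmod_meas_plane hF mC).
  - by move=> z _; rewrite lee_fin sqr_ge0.
move=> /(le_trans low) H.
have {}H := le_trans H (lee_wpmul2l (ltW C0 : (0 <= C%:E)%E) (test_fun_norm a0)).
have -> : (mu (carleson_box a) = (10 * al ^+ 2)%:E *
    (((10 * al ^+ 2)^-1)%:E * mu (carleson_box a)))%E.
  by rewrite muleA -EFinM divff ?mul1e// gt_eqF.
apply: (le_trans (lee_wpmul2l (ltW c0 : (0 <= (10 * al ^+ 2)%:E)%E) H)).
rewrite -!EFinM lee_fin -/al.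
have -> : 10 * al ^+ 2 * (C * ((2 * al)^-1 + pi / al ^+ 2)) = C * (5 * al + 10 * pi).
  move: al0; generalize al => r r0.
  by field; rewrite gt_eqF.
rewrite -mulrA ler_pM2l//.
have : 0 <= pi * al by rewrite mulr_ge0// ltW.
by lra.
Qed.

End necessity.

Theorem proposition2 (R : realType) (mu : {measure set (borelC R) -> \bar R}) :
  ((exists2 C : R, 0 < C &
      forall a : R[i], Cplus a ->
        (mu (carleson_box a) <= (C * complex.Re a)%:E)%E) ->
   carleson_measure mu)
  /\
  (carleson_measure mu ->
   exists2 C : R, 0 < C &
     forall a : R[i], Cplus a ->
       (mu (carleson_box a) <= (C * (complex.Re a + 1))%:E)%E).
Proof.
split; last exact: box_of_carleson.
by move=> [C C0 hC]; exact: carleson_of_box C0 hC.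
Qed.
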